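(* Let $(\gamma,\beta)\in\mathbb R^2\setminus\{(0,0)\}$ and let $\varphi:(0,1]\to\mathbb R$ be $\varphi(t)=t^\gamma\sin(t^{-\beta})$. Let $H(t)=\xi_{\varphi(t)}\xi_{\varphi(t)}^T$, let $W_H(1;z)$ be its monodromy matrix, and let $\kappa_H$ be the function produced by the algorithm with some fixed constant $c>0$. Then, as $r\to\infty$, \[ \log\Bigl(\max_{|z|=r}\|W_H(1;z)\|\Bigr)\asymp\log|w_{H,22}(1;ir)|\asymp\kappa_H(r)\asymp\begin{cases}r^{1/2},&\beta<\gamma+1,\\ r^{1/2}\log r,&\beta=\gamma+1,\\ r^{\hat\rho},&\beta>\gamma+1,\end{cases} \] where $\hat\rho=\frac{\beta}{\beta+\gamma+1}$ if $\gamma\ge0$ and $\hat\rho=\frac{\beta-\gamma}{\beta-\gamma+1}$ if $\gamma<0$.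
   Context: Notation: $\xi_\phi=(\cos\phi,\sin\phi)^T$. With $J=\begin{pmatrix}0&-1\\1&0\end{pmatrix}$, the fundamental solution $W_H(t;z)=(w_{H,ij}(t;z))$ solves $\partial_tW_H(t;z)J=zW_H(t;z)H(t)$ with $W_H(0;z)=I$ on $[0,1]$. $W_H(1;\cdot)$ is the monodromy matrix. Put $\Omega(s,t)=\int_s^tH$. Algorithm for $\kappa_H$ (constant $c$, interval $[0,1]$): for $r>0$ set $\sigma_0=0$. Recursively: - if $\det\Omega(\sigma_{j-1},1)>c/r^2$, let $\sigma_j$ be the unique point in $(\sigma_{j-1},1)$ with $\det\Omega(\sigma_{j-1},\sigma_j)=c/r^2$; - otherwise $\sigma_j=1$, $\kappa_H(r)=j$, and stop. Asymptotic notation: $f\asymp g$ as $r\to\infty$ means $C_1g(r)\le f(r)\le C_2g(r)$ for large $r$, with constants $C_1,C_2>0$. *)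

(* Defs.v *)
From Stdlib Require Import Reals.
From Coquelicot Require Import Coquelicot.
Open Scope R_scope.

Definition phi (gam bet t : R) : R := Rpower t gam * sin (Rpower t (- bet)).

Definition xi (a : R) (i : nat) : R := if Nat.eqb i 0 then cos a else sin a.
Definition Hmat (gam bet : R) (t : R) (i j : nat) : R :=
  xi (phi gam bet t) i * xi (phi gam bet t) j.

Definition Jmat (i j : nat) : R :=
  match i, j with
  | 0%nat, 1%nat => -1
  | 1%nat, 0%nat => 1
  | _, _ => 0
  end.

Definition Imat (i j : nat) : R := if Nat.eqb i j then 1 else 0.

(* W : R -> (nat -> nat -> C) is the fundamental solution of
   d/dt W(t) J = z W(t) H(t), W(0) = I on [0,1], in the (equivalent, absolutely
   continuous) integral form  W(t) J = J + z * int_0^t W(s) H(s) ds. *)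
Definition is_fund_sol (H : R -> nat -> nat -> R) (z : C)
  (W : R -> nat -> nat -> C) : Prop :=
  (forall i j, (i < 2)%nat -> (j < 2)%nat -> W 0 i j = RtoC (Imat i j)) /\
  forall t, 0 <= t <= 1 -> forall i j, (i < 2)%nat -> (j < 2)%nat ->
    exists v : C,
      is_RInt (V := C_R_CompleteNormedModule)
        (fun s => (W s i 0%nat * RtoC (H s 0%nat j) + W s i 1%nat * RtoC (H s 1%nat j))%C)
        0 t v /\
      (W t i 0%nat * RtoC (Jmat 0%nat j) + W t i 1%nat * RtoC (Jmat 1%nat j))%C
        = (RtoC (Jmat i j) + z * v)%C.

(* Frobenius norm of a 2x2 complex matrix (all matrix norms are equivalent). *)
Definition mnorm (M : nat -> nat -> C) : R :=
  sqrt (Cmod (M 0%nat 0%nat) ^ 2 + Cmod (M 0%nat 1%nat) ^ 2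
        + Cmod (M 1%nat 0%nat) ^ 2 + Cmod (M 1%nat 1%nat) ^ 2).

Definition max_circle (Wz : C -> nat -> nat -> C) (r : R) : R :=
  real (Lub_Rbar (fun x => exists z : C, Cmod z = r /\ x = mnorm (Wz z))).

Definition Omega (H : R -> nat -> nat -> R) (s t : R) (i j : nat) : R :=
  RInt (fun u => H u i j) s t.
Definition detOmega (H : R -> nat -> nat -> R) (s t : R) : R :=
  Omega H s t 0%nat 0%nat * Omega H s t 1%nat 1%nat
  - Omega H s t 0%nat 1%nat * Omega H s t 1%nat 0%nat.

(* The algorithm for kappa_H on [0,1] with constant c: kappa_is H c r k holds
   iff the run of the algorithm stops with kappa_H(r) = k, i.e. there are
   points sigma_0 = 0 < sigma_1 < ... < sigma_{k-1} < 1 (and sigma_k = 1) such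
   that for 1 <= j < k: det Omega(sigma_{j-1},1) > c/r^2, sigma_j is the unique
   point of (sigma_{j-1},1) with det Omega(sigma_{j-1},sigma_j) = c/r^2, and
   det Omega(sigma_{k-1},1) <= c/r^2. *)
Definition kappa_is (H : R -> nat -> nat -> R) (c r : R) (k : nat) : Prop :=
  (1 <= k)%nat /\
  exists sigma : nat -> R,
    sigma 0%nat = 0 /\
    (forall j, (1 <= j < k)%nat ->
       detOmega H (sigma (j - 1)%nat) 1 > c / r ^ 2 /\
       sigma (j - 1)%nat < sigma j < 1 /\
       detOmega H (sigma (j - 1)%nat) (sigma j) = c / r ^ 2 /\
       (forall s, sigma (j - 1)%nat < s < 1 ->
          detOmega H (sigma (j - 1)%nat) s = c / r ^ 2 -> s = sigma j)) /\
    detOmega H (sigma (k - 1)%nat) 1 <= c / r ^ 2.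

Definition asymp (f g : R -> R) : Prop :=
  exists C1 C2 R0 : R, 0 < C1 /\ 0 < C2 /\
    forall r, R0 <= r -> C1 * g r <= f r <= C2 * g r.

Definition rho_hat (gam bet : R) : R :=
  if Rle_dec 0 gam then bet / (bet + gam + 1) else (bet - gam) / (bet - gam + 1).

Definition growth (gam bet : R) (r : R) : R :=
  match Rlt_dec bet (gam + 1) with
  | left _ => sqrt r
  | right _ =>
      if Req_EM_T bet (gam + 1) then sqrt r * ln r
      else Rpower r (rho_hat gam bet)
  end.

(* Main.v *)
(* Each row y of W satisfies y' = z <y, xi> xi_perp.

   Lower bound for w_22(1; i r): for the second row, Im(w_22 conj(w_21)) =: Wr satisfies
   Wr' = r |<y, xi>|^2, and (|w_22|^2)' = 2 r cos^2(phi) Wr.  On an interval with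
   r^2 det Omega = c, comparing <y, xi> with <y(s), xi> shows that Wr grows by the fixed
   factor 1 + sqrt c / (1 + c).  Hence kappa = O(log |w_22(1; i r)| + log r).

   Upper bound for W: with p = bet + 1 - gam one has |phi'| <= K t^(-p).  On [r^(-1/q), 1] the
   row is followed in the frame rotating with phi, weighted by b = sqrt r t^(p/2), and its
   logarithm grows at most like sqrt r int t^(-p/2) dt; near 0 a constant frame suffices, as
   |sin phi| <= t^max(gam, 0).

   Lower bound for kappa: the algorithm is greedy, so it suffices to exhibit many disjoint
   intervals with det Omega > c / r^2.  Where |phi'| is comparable to t^(-p), intervals of
   length about (r t^(-p))^(-1/2) will do; such zones fill a fixed proportion of (0, 1], so
   their number is again of order sqrt r int t^(-p/2) dt. *)
Require Import Defs.
From Stdlib Require Import Reals Lra Lia.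
From Coquelicot Require Import Coquelicot.
Open Scope R_scope.

(** * Primitives and Gram determinants *)

(** The angle may oscillate without limit as t -> 0, so nothing is differentiated at 0. Integrals
    are represented by primitives that are continuous up to 0 and differentiable in (0, 1), and an
    integral inequality becomes the monotonicity of an explicit expression. Even the differential
    equation for the rows has to be extracted from the integral equation in this form. The exponents
    come from one balance. With g = max(gam, 0), the constant frame costs about r t0^(1 + g) on
    [0, t0], and for p > 2 the rotating frame costs about sqrt r t0^(1 - p/2) on [t0, 1]. The two
    agree for t0 = r^(-1/q) with q = p + 2 g = bet + 1 + |gam|, and their common value is r^rho_hat.
    The packing of the zones works down to the same t0, up to a constant factor, so the upper and
    the lower estimate stop at the same place. *)

Lemma continuous_Rplus (f g : R -> R) (t : R) :
  continuous f t -> continuous g t -> continuous (fun x => f x + g x) t.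
Proof. intros Hf Hg. exact (continuous_plus f g t Hf Hg). Qed.

Lemma continuous_Rminus (f g : R -> R) (t : R) :
  continuous f t -> continuous g t -> continuous (fun x => f x - g x) t.
Proof. intros Hf Hg. exact (continuous_minus f g t Hf Hg). Qed.

Lemma continuous_Rmult (f g : R -> R) (t : R) :
  continuous f t -> continuous g t -> continuous (fun x => f x * g x) t.
Proof. intros Hf Hg. exact (continuous_mult f g t Hf Hg). Qed.

Lemma continuous_Ropp (f : R -> R) (t : R) :
  continuous f t -> continuous (fun x => - f x) t.
Proof. intros Hf. exact (continuous_opp f t Hf). Qed.

Lemma continuous_Rpow (f : R -> R) (n : nat) (t : R) :
  continuous f t -> continuous (fun x => f x ^ n) t.
Proof.
  intros Hf. induction n as [|n IH]; simpl.
  - apply continuous_const.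
  - now apply continuous_Rmult.
Qed.

Ltac cont :=
  repeat match goal with
  | H : forall t, continuous ?P t |- continuous _ _ => solve [simple apply H]
  | |- continuous (fun x => @?f x + @?g x) _ => apply (continuous_Rplus f g)
  | |- continuous (fun x => @?f x - @?g x) _ => apply (continuous_Rminus f g)
  | |- continuous (fun x => - @?f x) _ => apply (continuous_Ropp f)
  | |- continuous (fun x => @?f x * @?g x) _ => apply (continuous_Rmult f g)
  | |- continuous (fun x => @?f x ^ ?n) _ => apply (continuous_Rpow f n)
  | |- continuous (fun _ => _) _ =>
      solve [simple apply continuous_id | simple apply continuous_const]
  end.

(** Takes the place of integration throughout: an integral estimate becomes monotonicity of a
    suitable combination of primitives. Derivatives are asked for in the open interval only, so that
    s = 0 is allowed. *)
Lemma nondecreasing_of_derive (F d : R -> R) (s t : R) :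
  s <= t ->
  (forall u, s <= u <= t -> continuous F u) ->
  (forall u, s < u < t -> is_derive F u (d u)) ->
  (forall u, s < u < t -> 0 <= d u) ->
  F s <= F t.
Proof.
  intros Hst Hc Hd Hp.
  (* [MVT_gen] may return an endpoint, where [d] has no known sign; 0 is a harmless value there. *)
  pose (d' := fun u => if Rlt_dec s u then if Rlt_dec u t then d u else 0 else 0).
  destruct (MVT_gen F s t d') as [u [_ Hu]].
  - intros u Hu. rewrite Rmin_left, Rmax_right in Hu by lra.
    unfold d'. destruct (Rlt_dec s u); [|lra]. destruct (Rlt_dec u t); [|lra].
    now apply Hd.
  - intros u Hu. rewrite Rmin_left, Rmax_right in Hu by lra.
    apply continuity_pt_filterlim, Hc, Hu.
  - assert (0 <= d' u).
    { unfold d'. destruct (Rlt_dec s u); [|lra]. destruct (Rlt_dec u t); [|lra].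
      now apply Hp. }
    assert (0 <= d' u * (t - s)) by (apply Rmult_le_pos; lra). lra.
Qed.

Lemma locally_Ioo (a b t : R) : a < t < b -> locally t (fun u => a < u < b).
Proof.
  intros [H1 H2].
  apply filter_and.
  - apply (locally_interval _ t a p_infty); simpl; auto.
  - apply (locally_interval _ t m_infty b); simpl; auto.
Qed.

(* Extending by zero outside [0,1] makes the primitive continuous at the endpoints as well. *)
Lemma primitive_01 (f : R -> R) :
  (forall t, 0 <= t <= 1 -> ex_RInt f 0 t) ->
  exists F : R -> R,
    (forall t, continuous F t) /\
    (forall t, 0 <= t <= 1 -> is_RInt f 0 t (F t)) /\
    (forall t, 0 < t < 1 -> continuous f t -> is_derive F t (f t)).
Proof.
  intros Hf.
  pose (g := fun s => if Rle_dec 0 s then if Rle_dec s 1 then f s else 0 else 0).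
  assert (Hg01 : forall t, 0 <= t <= 1 -> forall s, 0 < s < t -> f s = g s).
  { intros t Ht s Hs. unfold g.
    destruct (Rle_dec 0 s); [|lra]. destruct (Rle_dec s 1); [reflexivity|lra]. }
  assert (H01 : forall t, 0 <= t <= 1 -> ex_RInt g 0 t).
  { intros t Ht. apply (ex_RInt_ext f); [|now apply Hf].
    intros s Hs. rewrite Rmin_left, Rmax_right in Hs by lra.
    now apply (Hg01 t). }
  assert (Hg : forall t, ex_RInt g 0 t).
  { intros t. destruct (Rle_dec 0 t) as [H0|H0].
    - destruct (Rle_dec t 1) as [H1|H1]; [apply H01; lra|].
      apply (ex_RInt_Chasles g 0 1 t); [apply H01; lra|].
      apply (ex_RInt_ext (fun _ => 0)); [|apply ex_RInt_const].
      intros s Hs. rewrite Rmin_left, Rmax_right in Hs by lra.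
      unfold g. destruct (Rle_dec 0 s); [|lra]. destruct (Rle_dec s 1); [lra|reflexivity].
    - apply (ex_RInt_ext (fun _ => 0)); [|apply ex_RInt_const].
      intros s Hs. rewrite Rmin_right, Rmax_left in Hs by lra.
      unfold g. destruct (Rle_dec 0 s); [lra|reflexivity]. }
  exists (fun t => RInt g 0 t). split; [|split].
  - intros t. apply (continuous_RInt_1 g 0 t).
    apply filter_forall. intros u. now apply @RInt_correct.
  - intros t Ht. apply (is_RInt_ext g).
    + intros s Hs. rewrite Rmin_left, Rmax_right in Hs by lra.
      symmetry. now apply (Hg01 t).
    + now apply @RInt_correct.
  - intros t Ht Hc.
    assert (Hloc : locally t (fun u => f u = g u)).
    { apply (filter_imp (fun u => 0 < u < 1)); [|now apply locally_Ioo].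
      intros u Hu. now apply (Hg01 1); [lra|]. }
    replace (f t) with (g t) by (symmetry; exact (locally_singleton _ _ Hloc)).
    apply (is_derive_RInt g _ 0).
    + apply filter_forall. intros u. now apply @RInt_correct.
    + now apply (continuous_ext_loc g f t).
Qed.

(** The vectors (b, -a) and (c, -b) give the form the values a (a c - b^2) and c (a c - b^2). If a =
    c = 0, the vectors (1, 1) and (1, -1) force b = 0. *)
Lemma psd_det (a b c : R) :
  (forall x y, 0 <= x ^ 2 * a + 2 * x * y * b + y ^ 2 * c) ->
  0 <= a /\ 0 <= c /\ b ^ 2 <= a * c.
Proof.
  intros H.
  assert (Ha := H 1 0). assert (Hc := H 0 1).
  assert (H1 := H b (- a)). assert (H2 := H c (- b)).
  assert (H3 := H 1 1). assert (H4 := H 1 (-1)).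
  assert (0 <= a) by lra. assert (0 <= c) by lra.
  repeat split; try lra.
  destruct (Req_dec a 0) as [Ea|Ea].
  - destruct (Req_dec c 0) as [Ec|Ec].
    + assert (b = 0) by lra. subst. nra.
    + nra.
  - nra.
Qed.

(** The mixed discriminant of two positive semidefinite matrices is nonnegative: multiplying the two
    determinant bounds gives (b b')^2 <= (a c') (c a'), and the arithmetic-geometric mean does the
    rest. *)
Lemma psd_mixed (a b c a' b' c' : R) :
  0 <= a -> 0 <= c -> b ^ 2 <= a * c ->
  0 <= a' -> 0 <= c' -> b' ^ 2 <= a' * c' ->
  2 * (b * b') <= a * c' + c * a'.
Proof.
  intros.
  assert (Hm : (b * b') ^ 2 <= (a * c') * (c * a')).
  { replace ((b * b') ^ 2) with (b ^ 2 * b' ^ 2) by ring.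
    replace ((a * c') * (c * a')) with ((a * c) * (a' * c')) by ring.
    apply Rmult_le_compat; try lra; apply pow2_ge_0. }
  assert (0 <= a * c') by (apply Rmult_le_pos; lra).
  assert (0 <= c * a') by (apply Rmult_le_pos; lra).
  apply Rnot_lt_le. intros Hlt.
  assert (0 <= (a * c' - c * a') ^ 2) by apply pow2_ge_0.
  nra.
Qed.

(** The matrix H is present only through primitives of its entries; their increments from s to t are
    the entries of Omega(s, t). *)
Record gram (th P11 P12 P22 : R -> R) : Prop := {
  gram_c11 : forall t, continuous P11 t;
  gram_c12 : forall t, continuous P12 t;
  gram_c22 : forall t, continuous P22 t;
  gram_d11 : forall t, 0 < t < 1 -> is_derive P11 t (cos (th t) ^ 2);
  gram_d12 : forall t, 0 < t < 1 -> is_derive P12 t (cos (th t) * sin (th t));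
  gram_d22 : forall t, 0 < t < 1 -> is_derive P22 t (sin (th t) ^ 2) }.

(** This is det Omega(s, t), by the symmetry of Omega. *)
Definition gdet (P11 P12 P22 : R -> R) (s t : R) : R :=
  (P11 t - P11 s) * (P22 t - P22 s) - (P12 t - P12 s) ^ 2.

(* Components of a row y = (p1 + i q1, p2 + i q2) of the fundamental solution at
   z = x + i y: since J is a rotation, y' J = z y H reads
   y' = z <y, xi> (- sin th, cos th). *)
Record rowsol (th : R -> R) (x y : R) (p1 q1 p2 q2 : R -> R) : Prop := {
  row_c1 : forall t, continuous p1 t;
  row_c2 : forall t, continuous q1 t;
  row_c3 : forall t, continuous p2 t;
  row_c4 : forall t, continuous q2 t;
  row_d1 : forall t, 0 < t < 1 -> is_derive p1 t
    (- (x * (p1 t * cos (th t) + p2 t * sin (th t))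
        - y * (q1 t * cos (th t) + q2 t * sin (th t))) * sin (th t));
  row_d2 : forall t, 0 < t < 1 -> is_derive q1 t
    (- (x * (q1 t * cos (th t) + q2 t * sin (th t))
        + y * (p1 t * cos (th t) + p2 t * sin (th t))) * sin (th t));
  row_d3 : forall t, 0 < t < 1 -> is_derive p2 t
    ((x * (p1 t * cos (th t) + p2 t * sin (th t))
      - y * (q1 t * cos (th t) + q2 t * sin (th t))) * cos (th t));
  row_d4 : forall t, 0 < t < 1 -> is_derive q2 t
    ((x * (q1 t * cos (th t) + q2 t * sin (th t))
      + y * (p1 t * cos (th t) + p2 t * sin (th t))) * cos (th t)) }.

Ltac use_derive :=
  repeat match goal with
  | H : is_derive ?f ?u _ |- context [Derive ?g ?u] =>
      replace (Derive g u) with (Derive f u) by reflexivity;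
      rewrite (is_derive_unique f u _ H)
  end.

Ltac derive_tac :=
  auto_derive; [repeat split; auto; eexists; eassumption | use_derive; try ring].

Lemma sin2_cos2_pow (a : R) : sin a ^ 2 = 1 - cos a ^ 2.
Proof. rewrite <- !Rsqr_pow2. apply sin2. Qed.

Section Gram.
Context {th P11 P12 P22 : R -> R} (G : gram th P11 P12 P22).

(** The value is the integral of <(x, y), xi>^2 over [s, t]. *)
Lemma gram_form (s t x y : R) : 0 <= s <= t -> t <= 1 ->
  0 <= x ^ 2 * (P11 t - P11 s) + 2 * x * y * (P12 t - P12 s)
       + y ^ 2 * (P22 t - P22 s).
Proof.
  intros Hs Ht.
  assert (H := nondecreasing_of_derive
    (fun u => x ^ 2 * P11 u + 2 * x * y * P12 u + y ^ 2 * P22 u)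
    (fun u => (x * cos (th u) + y * sin (th u)) ^ 2) s t).
  enough (x ^ 2 * P11 s + 2 * x * y * P12 s + y ^ 2 * P22 s <=
          x ^ 2 * P11 t + 2 * x * y * P12 t + y ^ 2 * P22 t) by lra.
  apply H.
  - lra.
  - intros u _. destruct G. cont; auto.
  - intros u Hu. assert (Hu' : 0 < u < 1) by lra.
    assert (D1 := gram_d11 _ _ _ _ G u Hu').
    assert (D2 := gram_d12 _ _ _ _ G u Hu').
    assert (D3 := gram_d22 _ _ _ _ G u Hu').
    derive_tac.
  - intros u _. apply pow2_ge_0.
Qed.

Lemma gram_psd (s t : R) : 0 <= s <= t -> t <= 1 ->
  0 <= P11 t - P11 s /\ 0 <= P22 t - P22 s /\
  (P12 t - P12 s) ^ 2 <= (P11 t - P11 s) * (P22 t - P22 s).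
Proof. intros Hs Ht. apply psd_det. intros x y. now apply gram_form. Qed.

Lemma gdet_ge0 (s t : R) : 0 <= s <= t -> t <= 1 -> 0 <= gdet P11 P12 P22 s t.
Proof. intros Hs Ht. destruct (gram_psd s t Hs Ht) as [_ [_ H]]. unfold gdet. lra. Qed.

Lemma gram_trace (s t : R) : 0 <= s <= t -> t <= 1 ->
  (P11 t - P11 s) + (P22 t - P22 s) = t - s.
Proof.
  intros Hs Ht.
  (* The trace of H is 1; k = 1 and k = -1 give the two inequalities. *)
  assert (H : forall k, k ^ 2 = 1 ->
    k * (P11 s + P22 s - s) <= k * (P11 t + P22 t - t)).
  { intros k Hk.
    apply (nondecreasing_of_derive (fun u => k * (P11 u + P22 u - u)) (fun _ => 0)); try lra.
    - intros u _. destruct G. cont; auto.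
    - intros u Hu. assert (Hu' : 0 < u < 1) by lra.
      assert (D1 := gram_d11 _ _ _ _ G u Hu').
      assert (D3 := gram_d22 _ _ _ _ G u Hu').
      derive_tac. rewrite sin2_cos2_pow. ring.
    - intros u _. lra. }
  assert (H1 := H 1). assert (H2 := H (-1)). lra.
Qed.

(** With A and B the increments over [s, u] and [u, t], det (A + B) exceeds det A + det B by the
    mixed term of [psd_mixed]. *)
Lemma gdet_superadd (s u t : R) : 0 <= s <= u -> u <= t <= 1 ->
  gdet P11 P12 P22 s u + gdet P11 P12 P22 u t <= gdet P11 P12 P22 s t.
Proof.
  intros Hs Ht.
  destruct (gram_psd s u) as (A1 & A2 & A3); try lra.
  destruct (gram_psd u t) as (B1 & B2 & B3); try lra.
  assert (H := psd_mixed _ _ _ _ _ _ A1 A2 A3 B1 B2 B3).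
  unfold gdet. lra.
Qed.

Lemma gdet_mono (s s' t' t : R) : 0 <= s <= s' -> s' <= t' -> t' <= t <= 1 ->
  gdet P11 P12 P22 s' t' <= gdet P11 P12 P22 s t.
Proof.
  intros H1 H2 H3.
  assert (A := gdet_superadd s s' t ltac:(lra) ltac:(lra)).
  assert (B := gdet_superadd s' t' t ltac:(lra) ltac:(lra)).
  assert (C := gdet_ge0 s s' ltac:(lra) ltac:(lra)).
  assert (D := gdet_ge0 t' t ltac:(lra) ltac:(lra)).
  lra.
Qed.

(* The derivative of [gdet s] at [u] is the integral of [sin^2 (th - th u)] over [s, u]. *)
Lemma gdet_derive (s u : R) : 0 < u < 1 ->
  is_derive (gdet P11 P12 P22 s) u
    (cos (th u) ^ 2 * (P22 u - P22 s) - 2 * cos (th u) * sin (th u) * (P12 u - P12 s)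
     + sin (th u) ^ 2 * (P11 u - P11 s)).
Proof.
  intros Hu.
  assert (D1 := gram_d11 _ _ _ _ G u Hu).
  assert (D2 := gram_d12 _ _ _ _ G u Hu).
  assert (D3 := gram_d22 _ _ _ _ G u Hu).
  unfold gdet. derive_tac.
Qed.

End Gram.

(** * Growth on the imaginary axis *)

(** Cauchy-Schwarz without integrals: if F is the integral of |f|^2, Q that of g^2 for a real g, and
    a + i b that of f g, the hypothesis says that |f - (x + i y) g|^2 has a nonnegative integral.
    For Q > 0 it is applied at the minimiser (a / Q, b / Q). *)
Lemma quadratic_cauchy_schwarz (F Q a b : R) :
  (forall x y, 0 <= F - 2 * x * a - 2 * y * b + (x ^ 2 + y ^ 2) * Q) ->
  a ^ 2 + b ^ 2 <= F * Q.
Proof.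
  intros H.
  assert (HQ : 0 <= Q).
  { apply Rnot_lt_le. intros HQ.
    assert (H0 := H 0 0). assert (HF : 0 <= F) by lra.
    (* Here k (- Q) = F - Q and k >= 1, so F + k^2 Q <= Q < 0, against the sum of [H1] and [H2]. *)
    set (k := F / - Q + 1) in *.
    assert (H1 := H k 0). assert (H2 := H (- k) 0).
    assert (Hk : k * - Q = F - Q) by (unfold k; field; lra).
    assert (Hk1 : 1 <= k).
    { unfold k. assert (0 <= F / - Q) by (apply Rdiv_le_0_compat; lra). lra. }
    assert (k * - Q <= k * (k * - Q)) by nra.
    lra. }
  destruct (Req_dec Q 0) as [->|HQ0].
  - assert (H1 := H 0 0). rewrite Rmult_0_r. apply Rnot_lt_le. intros HT.
    set (T := a ^ 2 + b ^ 2) in *.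
    (* For Q = 0 the expression is affine in (x, y); this multiple of (a, b) brings it down to F - 2
       (F + 1) < 0. *)
    assert (H0 := H ((F + 1) / T * a) ((F + 1) / T * b)).
    replace (F - 2 * ((F + 1) / T * a) * a - 2 * ((F + 1) / T * b) * b
             + (((F + 1) / T * a) ^ 2 + ((F + 1) / T * b) ^ 2) * 0)
      with (F - 2 * ((F + 1) / T * T)) in H0 by (unfold T; ring).
    replace ((F + 1) / T * T) with (F + 1) in H0 by (field; lra).
    lra.
  - assert (H0 := H (a / Q) (b / Q)).
    replace (F - 2 * (a / Q) * a - 2 * (b / Q) * b + ((a / Q) ^ 2 + (b / Q) ^ 2) * Q)
      with ((F * Q - (a ^ 2 + b ^ 2)) / Q) in H0 by (field; lra).
    apply Rnot_lt_le. intros Hlt.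
    assert ((F * Q - (a ^ 2 + b ^ 2)) / Q < 0).
    { apply Rmult_lt_reg_r with Q; [lra|].
      unfold Rdiv. rewrite Rmult_assoc, Rinv_l by lra. lra. }
    lra.
Qed.

Definition wronski (p1 q1 p2 q2 : R -> R) (t : R) : R := q2 t * p1 t - p2 t * q1 t.

Section ImaginaryAxis.
Context {th P11 P12 P22 : R -> R} (G : gram th P11 P12 P22).
Context {r : R} {p1 q1 p2 q2 : R -> R} (Y : rowsol th 0 r p1 q1 p2 q2).

Let fr u := p1 u * cos (th u) + p2 u * sin (th u).
Let fi u := q1 u * cos (th u) + q2 u * sin (th u).
Let Wr := wronski p1 q1 p2 q2.

Ltac derivs u Hu :=
  let D1 := fresh in let D2 := fresh in let D3 := fresh in let D4 := fresh in
  let D5 := fresh in let D6 := fresh in let D7 := fresh in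
  assert (D1 := gram_d11 _ _ _ _ G u Hu);
  assert (D2 := gram_d12 _ _ _ _ G u Hu);
  assert (D3 := gram_d22 _ _ _ _ G u Hu);
  assert (D4 := row_d1 _ _ _ _ _ _ _ Y u Hu);
  assert (D5 := row_d2 _ _ _ _ _ _ _ Y u Hu);
  assert (D6 := row_d3 _ _ _ _ _ _ _ Y u Hu);
  assert (D7 := row_d4 _ _ _ _ _ _ _ Y u Hu).

Ltac conts := destruct G; destruct Y; cont; auto.

Lemma wronski_derive (u : R) : 0 < u < 1 ->
  is_derive Wr u (r * (fr u ^ 2 + fi u ^ 2)).
Proof.
  intros Hu. derivs u Hu. unfold Wr, wronski, fr, fi. derive_tac.
Qed.

Lemma wronski_continuous (u : R) : continuous Wr u.
Proof. unfold Wr, wronski. conts. Qed.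

Lemma wronski_incr (s t : R) : 0 < r -> 0 <= s <= t -> t <= 1 -> Wr s <= Wr t.
Proof.
  intros Hr Hs Ht.
  apply (nondecreasing_of_derive Wr (fun u => r * (fr u ^ 2 + fi u ^ 2))).
  - lra.
  - intros u _. apply wronski_continuous.
  - intros u Hu. apply wronski_derive. lra.
  - intros u _. assert (H1 := pow2_ge_0 (fr u)). assert (H2 := pow2_ge_0 (fi u)). nra.
Qed.

(* Cauchy-Schwarz for y(u) - y(s) = i r int f xi_perp, tested against (a, b). *)
Lemma increment_bound (s u a b : R) : 0 < r -> 0 <= s <= u -> u <= 1 ->
  (a * (p1 u - p1 s) + b * (p2 u - p2 s)) ^ 2
  + (a * (q1 u - q1 s) + b * (q2 u - q2 s)) ^ 2
  <= r * (Wr u - Wr s) *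
     (a ^ 2 * (P22 u - P22 s) - 2 * a * b * (P12 u - P12 s) + b ^ 2 * (P11 u - P11 s)).
Proof.
  intros Hr Hs Hu.
  set (A v := a * p1 v + b * p2 v). set (B v := a * q1 v + b * q2 v).
  set (Q v := a ^ 2 * P22 v - 2 * a * b * P12 v + b ^ 2 * P11 v).
  replace (a * (p1 u - p1 s) + b * (p2 u - p2 s)) with (A u - A s) by (unfold A; ring).
  replace (a * (q1 u - q1 s) + b * (q2 u - q2 s)) with (B u - B s) by (unfold B; ring).
  replace (a ^ 2 * (P22 u - P22 s) - 2 * a * b * (P12 u - P12 s) + b ^ 2 * (P11 u - P11 s))
    with (Q u - Q s) by (unfold Q; ring).
  apply quadratic_cauchy_schwarz. intros x y.
  enough (r * Wr s - 2 * x * A s - 2 * y * B s + (x ^ 2 + y ^ 2) * Q s <=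
          r * Wr u - 2 * x * A u - 2 * y * B u + (x ^ 2 + y ^ 2) * Q u) by lra.
  apply (nondecreasing_of_derive
    (fun v => r * Wr v - 2 * x * A v - 2 * y * B v + (x ^ 2 + y ^ 2) * Q v)
    (fun v => (- r * fi v - x * (b * cos (th v) - a * sin (th v))) ^ 2
              + (r * fr v - y * (b * cos (th v) - a * sin (th v))) ^ 2)).
  - lra.
  - intros v _. unfold Wr, wronski, A, B, Q. conts.
  - intros v Hv. assert (Hv' : 0 < v < 1) by lra. derivs v Hv'.
    unfold Wr, wronski, A, B, Q, fr, fi. derive_tac.
  - intros v _. apply Rplus_le_le_0_compat; apply pow2_ge_0.
Qed.

(* The quadratic form y(s) Omega(s,t) y(s)^* is the integral of |<y(s), xi>|^2, and
   |<y(s), xi(u)>|^2 <= 2 |f(u)|^2 + 2 r^2 F(u) D'(u) where F' = |f|^2 and D = det Omega(s,.). *)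
Lemma form_bound (s t : R) : 0 < r -> 0 <= s <= t -> t <= 1 ->
  r * ((p1 s ^ 2 + q1 s ^ 2) * (P11 t - P11 s)
       + 2 * (p1 s * p2 s + q1 s * q2 s) * (P12 t - P12 s)
       + (p2 s ^ 2 + q2 s ^ 2) * (P22 t - P22 s))
  <= 2 * (Wr t - Wr s) * (1 + r ^ 2 * gdet P11 P12 P22 s t).
Proof.
  intros Hr Hs Ht.
  set (g u := r * ((p1 s ^ 2 + q1 s ^ 2) * (P11 u - P11 s)
       + 2 * (p1 s * p2 s + q1 s * q2 s) * (P12 u - P12 s)
       + (p2 s ^ 2 + q2 s ^ 2) * (P22 u - P22 s))).
  set (D := gdet P11 P12 P22 s).
  set (D' u := cos (th u) ^ 2 * (P22 u - P22 s)
         - 2 * cos (th u) * sin (th u) * (P12 u - P12 s)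
         + sin (th u) ^ 2 * (P11 u - P11 s)).
  enough (2 * (Wr s - Wr s) * (1 + r ^ 2 * D s) - g s <=
          2 * (Wr t - Wr s) * (1 + r ^ 2 * D t) - g t).
  { assert (g s = 0) by (unfold g; ring). unfold g in *. lra. }
  apply (nondecreasing_of_derive
    (fun u => 2 * (Wr u - Wr s) * (1 + r ^ 2 * D u) - g u)
    (fun u => 2 * (r * (fr u ^ 2 + fi u ^ 2)) * (1 + r ^ 2 * D u)
       + 2 * (Wr u - Wr s) * (r ^ 2 * D' u)
       - r * ((p1 s * cos (th u) + p2 s * sin (th u)) ^ 2
              + (q1 s * cos (th u) + q2 s * sin (th u)) ^ 2))).
  - lra.
  - intros u _. unfold D, gdet, g, Wr, wronski. conts.
  - intros u Hu. assert (Hu' : 0 < u < 1) by lra.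
    assert (E1 := wronski_derive u Hu').
    assert (E2 := gdet_derive G s u Hu').
    fold D in E2. fold (D' u) in E2.
    derivs u Hu'. unfold g. clearbody Wr D D'. derive_tac.
  - intros u Hu.
    assert (HA := increment_bound s u (cos (th u)) (sin (th u)) Hr ltac:(lra) ltac:(lra)).
    assert (HD : 0 <= D u) by (apply (gdet_ge0 G); lra).
    fold (D' u) in HA.
    set (h1 := cos (th u) * (p1 u - p1 s) + sin (th u) * (p2 u - p2 s)) in HA.
    set (h2 := cos (th u) * (q1 u - q1 s) + sin (th u) * (q2 u - q2 s)) in HA.
    replace (p1 s * cos (th u) + p2 s * sin (th u)) with (fr u - h1)
      by (unfold fr, h1; ring).
    replace (q1 s * cos (th u) + q2 s * sin (th u)) with (fi u - h2)
      by (unfold fi, h2; ring).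
    assert (K1 : 0 <= (fr u + h1) ^ 2) by apply pow2_ge_0.
    assert (K2 : 0 <= (fi u + h2) ^ 2) by apply pow2_ge_0.
    assert (K3 : 0 <= r * (fr u ^ 2 + fi u ^ 2) * (r ^ 2 * D u)).
    { assert (0 <= fr u ^ 2) by apply pow2_ge_0. assert (0 <= fi u ^ 2) by apply pow2_ge_0.
      assert (0 <= r ^ 2) by apply pow2_ge_0.
      repeat apply Rmult_le_pos; lra. }
    assert (K4 : r * ((fr u - h1) ^ 2 + (fi u - h2) ^ 2)
              <= r * (2 * (fr u ^ 2 + fi u ^ 2) + 2 * (h1 ^ 2 + h2 ^ 2))).
    { apply Rmult_le_compat_l; lra. }
    assert (K5 : r * (h1 ^ 2 + h2 ^ 2) <= r * (r * (Wr u - Wr s) * D' u)).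
    { apply Rmult_le_compat_l; lra. }
    lra.
Qed.

(** U and V are the values of the form Omega(s, t) at the real and the imaginary part of y(s), and M
    is its mixed value. Their Gram determinant U V - M^2 equals det Omega times Wr(s)^2, so the
    arithmetic-geometric mean gives r (U + V) >= 2 sqrt c Wr(s), while [form_bound] gives r (U + V)
    <= 2 (1 + c) (Wr(t) - Wr(s)). *)
Lemma wronski_growth (s t c : R) : 0 < r -> 0 < c -> 0 <= s <= t -> t <= 1 ->
  r ^ 2 * gdet P11 P12 P22 s t = c -> 0 <= Wr s ->
  (1 + sqrt c / (1 + c)) * Wr s <= Wr t.
Proof.
  intros Hr Hc Hs Ht HD HS.
  assert (HF := form_bound s t Hr Hs Ht). rewrite HD in HF.
  destruct (gram_psd G s t Hs Ht) as (A1 & A2 & A3).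
  set (a := P11 t - P11 s) in *. set (b := P12 t - P12 s) in *. set (d := P22 t - P22 s) in *.
  set (U := p1 s ^ 2 * a + 2 * p1 s * p2 s * b + p2 s ^ 2 * d).
  set (V := q1 s ^ 2 * a + 2 * q1 s * q2 s * b + q2 s ^ 2 * d).
  assert (HU : 0 <= U) by (apply (gram_form G); lra).
  assert (HV : 0 <= V) by (apply (gram_form G); lra).
  set (M := p1 s * q1 s * a + (p1 s * q2 s + p2 s * q1 s) * b + p2 s * q2 s * d).
  assert (HUV : U * V = M ^ 2 + gdet P11 P12 P22 s t * Wr s ^ 2).
  { unfold U, V, M, gdet, Wr, wronski, a, b, d. ring. }
  assert (Hsq : sqrt c * Wr s <= r * (U + V) / 2).
  { apply Rsqr_incr_0_var.
    - rewrite Rsqr_mult, Rsqr_sqrt by lra. rewrite <- HD. unfold Rsqr.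
      assert (0 <= (r * (U - V)) ^ 2) by apply pow2_ge_0.
      assert (0 <= (r * M) ^ 2) by apply pow2_ge_0.
      assert (E : r ^ 2 * (U * V) = (r * M) ^ 2 + r ^ 2 * gdet P11 P12 P22 s t * (Wr s * Wr s))
        by (rewrite HUV; ring).
      nra.
    - assert (0 <= r * (U + V)) by (apply Rmult_le_pos; lra). lra. }
  assert (HF' : r * (U + V) <= 2 * (Wr t - Wr s) * (1 + c)).
  { replace (U + V) with ((p1 s ^ 2 + q1 s ^ 2) * a + 2 * (p1 s * p2 s + q1 s * q2 s) * b
       + (p2 s ^ 2 + q2 s ^ 2) * d) by (unfold U, V; ring). exact HF. }
  assert (sqrt c * Wr s <= (Wr t - Wr s) * (1 + c)) by lra.
  apply Rmult_le_reg_r with (1 + c); [lra|].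
  replace ((1 + sqrt c / (1 + c)) * Wr s * (1 + c)) with (Wr s * (1 + c) + sqrt c * Wr s)
    by (field; lra).
  lra.
Qed.

(** [wronski_growth] says nothing while Wr = 0, as is the case at 0. For the row (0, 1) the form in
    [form_bound] is the integral of sin^2, which is at least det Omega because the other diagonal
    entry is at most 1. *)
Lemma wronski_start (t c : R) : 0 < r -> 0 < c -> 0 <= t <= 1 ->
  r ^ 2 * gdet P11 P12 P22 0 t = c ->
  p1 0 = 0 -> q1 0 = 0 -> p2 0 = 1 -> q2 0 = 0 ->
  c / (2 * (1 + c) * r) <= Wr t.
Proof.
  intros Hr Hc Ht HD I1 I2 I3 I4.
  assert (HF := form_bound 0 t Hr ltac:(lra) ltac:(lra)). rewrite HD in HF.
  assert (HS0 : Wr 0 = 0) by (unfold Wr, wronski; rewrite I1, I2, I3, I4; ring).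
  rewrite I1, I2, I3, I4, HS0 in HF.
  destruct (gram_psd G 0 t ltac:(lra) ltac:(lra)) as (A1 & A2 & A3).
  assert (A4 := gram_trace G 0 t ltac:(lra) ltac:(lra)).
  unfold gdet in HD.
  set (a := P11 t - P11 0) in *. set (b := P12 t - P12 0) in *. set (d := P22 t - P22 0) in *.
  assert (Hd : c <= r ^ 2 * d).
  { rewrite <- HD. apply Rmult_le_compat_l; [apply pow2_ge_0|].
    assert (0 <= b ^ 2) by apply pow2_ge_0.
    assert (a * d <= 1 * d) by (apply Rmult_le_compat_r; lra). lra. }
  apply Rmult_le_reg_r with (2 * (1 + c) * r); [apply Rmult_lt_0_compat; lra|].
  replace (c / (2 * (1 + c) * r) * (2 * (1 + c) * r)) with c by (field; lra).
  apply Rmult_le_compat_l with (r := r) in HF; [|lra].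
  nra.
Qed.

Lemma norm2_derive (u : R) : 0 < u < 1 ->
  is_derive (fun u => p2 u ^ 2 + q2 u ^ 2) u (2 * r * cos (th u) ^ 2 * Wr u).
Proof.
  intros Hu. derivs u Hu. unfold Wr, wronski. derive_tac.
Qed.

(** Wr is nondecreasing, so m stays below it on all of [s, t]. *)
Lemma norm2_growth (s t m : R) : 0 < r -> 0 <= s <= t -> t <= 1 -> 0 <= m -> m <= Wr s ->
  p2 s ^ 2 + q2 s ^ 2 + 2 * r * m * (P11 t - P11 s) <= p2 t ^ 2 + q2 t ^ 2.
Proof.
  intros Hr Hs Ht Hm HS.
  enough (p2 s ^ 2 + q2 s ^ 2 - 2 * r * m * P11 s <= p2 t ^ 2 + q2 t ^ 2 - 2 * r * m * P11 t)
    by lra.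
  apply (nondecreasing_of_derive
    (fun u => p2 u ^ 2 + q2 u ^ 2 - 2 * r * m * P11 u)
    (fun u => 2 * r * cos (th u) ^ 2 * Wr u - 2 * r * m * cos (th u) ^ 2)).
  - lra.
  - intros u _. conts.
  - intros u Hu. assert (Hu' : 0 < u < 1) by lra.
    assert (E1 := norm2_derive u Hu').
    assert (E2 := gram_d11 _ _ _ _ G u Hu').
    apply (is_derive_minus (fun u => p2 u ^ 2 + q2 u ^ 2) (fun u => 2 * r * m * P11 u));
      [exact E1|]. derive_tac.
  - intros u Hu.
    assert (m <= Wr u) by (apply Rle_trans with (Wr s); [exact HS|apply wronski_incr; lra]).
    assert (0 <= cos (th u) ^ 2) by apply pow2_ge_0.
    replace (2 * r * cos (th u) ^ 2 * Wr u - 2 * r * m * cos (th u) ^ 2)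
      with (2 * r * cos (th u) ^ 2 * (Wr u - m)) by ring.
    apply Rmult_le_pos; [apply Rmult_le_pos|]; lra.
Qed.

(* On the last full step |w_22|^2 grows by at least 2 r Wr(s) int cos^2, and there
   int cos^2 >= det Omega = c / r^2. *)
Lemma norm2_lower (c : R) (k : nat) (sigma : nat -> R) :
  0 < r -> 0 < c ->
  p1 0 = 0 -> q1 0 = 0 -> p2 0 = 1 -> q2 0 = 0 ->
  sigma 0%nat = 0 ->
  (forall j, (1 <= j < k)%nat -> sigma (j - 1)%nat < sigma j < 1 /\
     r ^ 2 * gdet P11 P12 P22 (sigma (j - 1)%nat) (sigma j) = c) ->
  1 <= p2 1 ^ 2 + q2 1 ^ 2 /\
  ((3 <= k)%nat ->
   c ^ 2 / ((1 + c) * r ^ 2) * (1 + sqrt c / (1 + c)) ^ (k - 3) <= p2 1 ^ 2 + q2 1 ^ 2).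
Proof.
  intros Hr Hc I1 I2 I3 I4 H0 Hj.
  assert (HS0 : Wr 0 = 0) by (unfold Wr, wronski; rewrite I1, I2, I3, I4; ring).
  split.
  { assert (H := norm2_growth 0 1 0 Hr ltac:(lra) ltac:(lra) ltac:(lra) ltac:(lra)).
    rewrite I3, I4 in H. lra. }
  intros Hk.
  assert (Hpos : forall j, (j < k)%nat -> 0 <= sigma j).
  { induction j as [|j IH]; intros Hjk; [lra|].
    destruct (Hj (S j) ltac:(lia)) as [H1 _].
    replace (S j - 1)%nat with j in H1 by lia.
    specialize (IH ltac:(lia)). lra. }
  set (q := 1 + sqrt c / (1 + c)).
  assert (Hq : 0 < q).
  { unfold q. assert (0 <= sqrt c / (1 + c)) by (apply Rdiv_le_0_compat; [apply sqrt_pos|lra]).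
    lra. }
  set (m0 := c / (2 * (1 + c) * r)).
  assert (Hm0 : 0 < m0) by (apply Rdiv_lt_0_compat; [lra|apply Rmult_lt_0_compat; lra]).
  (* Of the k - 1 full steps the first only makes Wr positive and the last is kept for |w_22|^2; the
     k - 3 steps between them multiply Wr by q. *)
  assert (Hgrow : forall j, (S j < k)%nat -> m0 * q ^ j <= Wr (sigma (S j))).
  { induction j as [|j IH]; intros Hjk.
    - destruct (Hj 1%nat ltac:(lia)) as [H1 H2]. simpl in H1, H2. rewrite H0 in H1, H2.
      simpl. rewrite Rmult_1_r. apply wronski_start; auto. lra.
    - destruct (Hj (S (S j)) ltac:(lia)) as [H1 H2].
      replace (S (S j) - 1)%nat with (S j) in H1, H2 by lia.
      specialize (IH ltac:(lia)).
      assert (Hp := Hpos (S j) ltac:(lia)).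
      assert (0 < m0 * q ^ j) by (apply Rmult_lt_0_compat; [lra|now apply pow_lt]).
      assert (HH := wronski_growth (sigma (S j)) (sigma (S (S j))) c Hr Hc ltac:(lra) ltac:(lra) H2 ltac:(lra)).
      fold q in HH.
      replace (m0 * q ^ S j) with (q * (m0 * q ^ j)) by (simpl; ring).
      apply Rle_trans with (2 := HH). apply Rmult_le_compat_l; lra. }
  set (s := sigma (k - 2)%nat). set (t := sigma (k - 1)%nat).
  destruct (Hj (k - 1)%nat ltac:(lia)) as [H1 H2].
  replace (k - 1 - 1)%nat with (k - 2)%nat in H1, H2 by lia.
  fold s t in H1, H2.
  assert (Hs : 0 <= s) by (apply Hpos; lia).
  assert (Hm : m0 * q ^ (k - 3) <= Wr s).
  { unfold s. replace (k - 2)%nat with (S (k - 3)) by lia. apply Hgrow. lia. }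
  assert (Hmp : 0 < m0 * q ^ (k - 3)) by (apply Rmult_lt_0_compat; [lra|now apply pow_lt]).
  assert (N1 := norm2_growth s t _ Hr ltac:(lra) ltac:(lra) (Rlt_le _ _ Hmp) Hm).
  assert (HSt : 0 <= Wr t).
  { apply Rle_trans with (Wr s); [lra|]. apply wronski_incr; lra. }
  assert (N2 := norm2_growth t 1 0 Hr ltac:(lra) ltac:(lra) ltac:(lra) HSt).
  destruct (gram_psd G s t ltac:(lra) ltac:(lra)) as (A1 & A2 & A3).
  assert (A4 := gram_trace G s t ltac:(lra) ltac:(lra)).
  assert (Hd : c / r ^ 2 <= P11 t - P11 s).
  { apply Rmult_le_reg_l with (r ^ 2); [now apply pow_lt|].
    replace (r ^ 2 * (c / r ^ 2)) with c by (field; lra).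
    rewrite <- H2. apply Rmult_le_compat_l; [apply pow2_ge_0|]. unfold gdet.
    assert (0 <= (P12 t - P12 s) ^ 2) by apply pow2_ge_0.
    assert ((P11 t - P11 s) * (P22 t - P22 s) <= (P11 t - P11 s) * 1)
      by (apply Rmult_le_compat_l; lra).
    lra. }
  assert (Hfin : 2 * r * (m0 * q ^ (k - 3)) * (c / r ^ 2)
            <= 2 * r * (m0 * q ^ (k - 3)) * (P11 t - P11 s)).
  { apply Rmult_le_compat_l; [|exact Hd]. apply Rmult_le_pos; lra. }
  replace (c ^ 2 / ((1 + c) * r ^ 2) * q ^ (k - 3))
    with (2 * r * (m0 * q ^ (k - 3)) * (c / r ^ 2)) by (unfold m0; field; lra).
  assert (0 <= p2 s ^ 2) by apply pow2_ge_0. assert (0 <= q2 s ^ 2) by apply pow2_ge_0.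
  lra.
Qed.

End ImaginaryAxis.

(** * Upper bounds for a row *)

(** The function N exp (- k) is nonincreasing. The rate is given by its primitive [k], so no
    integral occurs. *)
Lemma gronwall (N dN k dk : R -> R) (s t : R) :
  s <= t ->
  (forall u, s <= u <= t -> continuous N u) ->
  (forall u, s <= u <= t -> continuous k u) ->
  (forall u, s < u < t -> is_derive N u (dN u)) ->
  (forall u, s < u < t -> is_derive k u (dk u)) ->
  (forall u, s < u < t -> dN u <= dk u * N u) ->
  N t <= exp (k t - k s) * N s.
Proof.
  intros Hst HcN Hck HdN Hdk Hle.
  assert (H : - (N s * exp (- k s)) <= - (N t * exp (- k t))).
  { apply (nondecreasing_of_derive (fun u => - (N u * exp (- k u)))
      (fun u => exp (- k u) * (dk u * N u - dN u))).
    - exact Hst.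
    - intros u Hu. apply continuous_Ropp, continuous_Rmult; [now apply HcN|].
      apply (continuous_comp (fun v => - k v) exp).
      + now apply continuous_Ropp, Hck.
      + apply (ex_derive_continuous exp). auto_derive. exact I.
    - intros u Hu. assert (D1 := HdN u Hu). assert (D2 := Hdk u Hu). derive_tac.
    - intros u Hu. apply Rmult_le_pos; [left; apply exp_pos|].
      specialize (Hle u Hu). lra. }
  replace (exp (k t - k s) * N s) with (exp (k t) * (N s * exp (- k s))).
  2:{ unfold Rminus. rewrite exp_plus. ring. }
  replace (N t) with (exp (k t) * (N t * exp (- k t))).
  2:{ rewrite exp_Ropp. field. apply Rgt_not_eq, exp_pos. }
  apply Rmult_le_compat_l; [left; apply exp_pos|lra].
Qed.

(** With u = a + i b, v = f + i g and z = x + i y the left side is |Re (conj u z v)| <= r |u| |v|;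
    the arithmetic-geometric mean with the free weight e finishes. *)
Lemma abs_re_mul_le (x y r a b f g e : R) :
  0 < r -> x ^ 2 + y ^ 2 = r ^ 2 -> 0 < e ->
  Rabs (a * (x * f - y * g) + b * (x * g + y * f))
  <= r * (e * (a ^ 2 + b ^ 2) + (f ^ 2 + g ^ 2) / e) / 2.
Proof.
  intros Hr Hxy He.
  assert (Hs : forall k, k ^ 2 = 1 ->
    k * (a * (x * f - y * g) + b * (x * g + y * f))
    <= r * (e * (a ^ 2 + b ^ 2) + (f ^ 2 + g ^ 2) / e) / 2).
  { intros k Hk.
    assert (H1 := pow2_ge_0 (r * e * a - k * (x * f - y * g))).
    assert (H2 := pow2_ge_0 (r * e * b - k * (x * g + y * f))).
    apply Rmult_le_reg_l with (2 * (r * e)); [apply Rmult_lt_0_compat; [lra|nra]|].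
    replace (2 * (r * e) * (r * (e * (a ^ 2 + b ^ 2) + (f ^ 2 + g ^ 2) / e) / 2))
      with ((r * e) ^ 2 * (a ^ 2 + b ^ 2) + k ^ 2 * (r ^ 2 * (f ^ 2 + g ^ 2)))
      by (rewrite Hk; field; lra).
    rewrite <- Hxy. nra. }
  apply Rabs_le. assert (H1 := Hs 1). assert (H2 := Hs (-1)). lra.
Qed.

Lemma abs_dot_le (a b f g e : R) : 0 < e ->
  Rabs (a * f + b * g) <= (e * (a ^ 2 + b ^ 2) + (f ^ 2 + g ^ 2) / e) / 2.
Proof.
  intros He. assert (H := abs_re_mul_le 1 0 1 a b f g e).
  replace (a * (1 * f - 0 * g) + b * (1 * g + 0 * f)) with (a * f + b * g) in H by ring.
  rewrite Rmult_1_l in H. apply H; lra.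
Qed.

Section UpperBound.
Context {th : R -> R} {x y r : R} {p1 q1 p2 q2 : R -> R}.
Context (Y : rowsol th x y p1 q1 p2 q2) (Hr : 0 < r) (Hxy : x ^ 2 + y ^ 2 = r ^ 2).

Ltac derivs u Hu :=
  let D4 := fresh in let D5 := fresh in let D6 := fresh in let D7 := fresh in
  assert (D4 := row_d1 _ _ _ _ _ _ _ Y u Hu);
  assert (D5 := row_d2 _ _ _ _ _ _ _ Y u Hu);
  assert (D6 := row_d3 _ _ _ _ _ _ _ Y u Hu);
  assert (D7 := row_d4 _ _ _ _ _ _ _ Y u Hu).

Lemma abs_x_le : Rabs x <= r.
Proof. apply Rabs_le. split; nra. Qed.

(** In coordinates y1' = - z (y1 sin cos + y2 sin^2) and y2' = z (y1 cos^2 + y2 sin cos). The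
    coupling of y2 into y1 has size r a^2, that of y1 into y2 has size r; the weights 1 / a and a
    bring both to r a, the size of the diagonal terms. For a = 1 this is the trivial bound. *)
Lemma upper_bound_small_sin (a t : R) :
  0 < a <= 1 -> 0 <= t <= 1 ->
  (forall u, 0 < u < t -> Rabs (sin (th u)) <= a) ->
  (p1 t ^ 2 + q1 t ^ 2) / a + a * (p2 t ^ 2 + q2 t ^ 2)
  <= exp (4 * r * a * t) * ((p1 0 ^ 2 + q1 0 ^ 2) / a + a * (p2 0 ^ 2 + q2 0 ^ 2)).
Proof.
  intros Ha Ht Hsin.
  set (A u := p1 u ^ 2 + q1 u ^ 2). set (B u := p2 u ^ 2 + q2 u ^ 2).
  set (X u := p1 u * (x * p2 u - y * q2 u) + q1 u * (x * q2 u + y * p2 u)).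
  set (Z u := p2 u * (x * p1 u - y * q1 u) + q2 u * (x * q1 u + y * p1 u)).
  replace (4 * r * a * t) with (4 * r * a * t - 4 * r * a * 0) by ring.
  apply (gronwall (fun u => A u / a + a * B u)
    (fun u => 2 / a * (- sin (th u) * cos (th u) * x * A u - sin (th u) ^ 2 * X u)
      + 2 * a * (cos (th u) ^ 2 * Z u + cos (th u) * sin (th u) * x * B u))
    (fun u => 4 * r * a * u) (fun _ => 4 * r * a)).
  - lra.
  - intros u _. unfold A, B, Rdiv. destruct Y. cont.
  - intros u _. cont.
  - intros u Hu. assert (Hu' : 0 < u < 1) by lra. derivs u Hu'.
    unfold A, B, X, Z. derive_tac. field. lra.
  - intros u Hu. auto_derive; [exact I|ring].
  - intros u Hu. specialize (Hsin u Hu).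
    assert (Hx := abs_x_le).
    assert (HX : Rabs (X u) <= r * (A u / a + a * B u) / 2).
    { assert (H := abs_re_mul_le x y r (p1 u) (q1 u) (p2 u) (q2 u) (/ a) Hr Hxy
        ltac:(apply Rinv_0_lt_compat; lra)).
      fold (A u) (B u) (X u) in H.
      replace (/ a * A u + B u / / a) with (A u / a + a * B u) in H by (field; lra).
      exact H. }
    assert (HZ : Rabs (Z u) <= r * (A u / a + a * B u) / 2).
    { assert (H := abs_re_mul_le x y r (p2 u) (q2 u) (p1 u) (q1 u) a Hr Hxy ltac:(lra)).
      fold (A u) (B u) (Z u) in H.
      replace (a * B u + A u / a) with (A u / a + a * B u) in H by ring.
      exact H. }
    assert (HA : 0 <= A u) by (apply Rplus_le_le_0_compat; apply pow2_ge_0).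
    assert (HB : 0 <= B u) by (apply Rplus_le_le_0_compat; apply pow2_ge_0).
    assert (Hcos : Rabs (cos (th u)) <= 1) by (apply Rabs_le, COS_bound).
    assert (HM : 0 <= A u / a + a * B u).
    { apply Rplus_le_le_0_compat; [apply Rdiv_le_0_compat|apply Rmult_le_pos]; lra. }
    set (M := A u / a + a * B u) in *.
    assert (Hsc : Rabs (sin (th u) * cos (th u)) <= a).
    { rewrite Rabs_mult, <- (Rmult_1_r a).
      apply Rmult_le_compat; auto using Rabs_pos. }
    assert (Hscx : Rabs (sin (th u) * cos (th u) * x) <= a * r).
    { rewrite Rabs_mult. apply Rmult_le_compat; auto using Rabs_pos. }
    assert (T1 : - sin (th u) * cos (th u) * x * A u <= a * r * A u).
    { apply Rmult_le_compat_r; [exact HA|].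
      apply Rabs_le_between in Hscx. lra. }
    assert (T4 : cos (th u) * sin (th u) * x * B u <= a * r * B u).
    { apply Rmult_le_compat_r; [exact HB|].
      apply Rabs_le_between in Hscx. lra. }
    assert (Hs2 : sin (th u) ^ 2 <= a ^ 2).
    { rewrite <- (pow2_abs (sin (th u))). apply pow_incr. split; [apply Rabs_pos|exact Hsin]. }
    assert (Hc2 : cos (th u) ^ 2 <= 1).
    { rewrite <- (pow2_abs (cos (th u))), <- (pow1 2). apply pow_incr.
      split; [apply Rabs_pos|exact Hcos]. }
    assert (T2 : - sin (th u) ^ 2 * X u <= a ^ 2 * (r * M / 2)).
    { apply Rle_trans with (sin (th u) ^ 2 * Rabs (X u)).
      - assert (0 <= sin (th u) ^ 2) by apply pow2_ge_0.
        assert (H2 := Rle_abs (- X u)). rewrite Rabs_Ropp in H2. nra.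
      - apply Rmult_le_compat; [apply pow2_ge_0|apply Rabs_pos|exact Hs2|exact HX]. }
    assert (T3 : cos (th u) ^ 2 * Z u <= 1 * (r * M / 2)).
    { apply Rle_trans with (cos (th u) ^ 2 * Rabs (Z u)).
      - apply Rmult_le_compat_l; [apply pow2_ge_0|apply Rle_abs].
      - apply Rmult_le_compat; [apply pow2_ge_0|apply Rabs_pos|exact Hc2|exact HZ]. }
    apply Rle_trans with (2 / a * (a * r * A u + a ^ 2 * (r * M / 2))
      + 2 * a * (1 * (r * M / 2) + a * r * B u)).
    + apply Rplus_le_compat; apply Rmult_le_compat_l; try lra.
      apply Rdiv_le_0_compat; lra.
    + right. unfold M. field. lra.
Qed.

(** For f = <y, xi> and g = <y, xi_perp> one has f' = th' g and g' = (z - th') f: the large factor z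
    now couples in one direction only. In b |f|^2 + |g|^2 / b the first coupling costs b |th'|, the
    second (r + |th'|) / b, and the moving weight |b'| / b. *)
Lemma upper_bound_rotating (dth b db m k dk : R -> R) (s t : R) :
  0 < s <= t -> t <= 1 ->
  (forall u, s <= u <= t -> continuous th u) ->
  (forall u, s <= u <= t -> continuous b u) ->
  (forall u, s <= u <= t -> continuous k u) ->
  (forall u, s <= u <= t -> 0 < b u) ->
  (forall u, s < u < t -> is_derive th u (dth u)) ->
  (forall u, s < u < t -> is_derive b u (db u)) ->
  (forall u, s < u < t -> is_derive k u (dk u)) ->
  (forall u, s < u < t -> Rabs (dth u) <= m u) ->
  (forall u, s < u < t -> Rabs (db u) / b u + b u * m u + (r + m u) / b u <= dk u) ->
  let N u := b u * ((p1 u * cos (th u) + p2 u * sin (th u)) ^ 2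
                    + (q1 u * cos (th u) + q2 u * sin (th u)) ^ 2)
             + ((p2 u * cos (th u) - p1 u * sin (th u)) ^ 2
                + (q2 u * cos (th u) - q1 u * sin (th u)) ^ 2) / b u in
  N t <= exp (k t - k s) * N s.
Proof.
  intros Hs Ht Hcth Hcb Hck Hb Hdth Hdb Hdk Hm Hrate N.
  set (fr u := p1 u * cos (th u) + p2 u * sin (th u)).
  set (fi u := q1 u * cos (th u) + q2 u * sin (th u)).
  set (gr u := p2 u * cos (th u) - p1 u * sin (th u)).
  set (gi u := q2 u * cos (th u) - q1 u * sin (th u)).
  set (dot u := fr u * gr u + fi u * gi u).
  set (X u := gr u * (x * fr u - y * fi u) + gi u * (x * fi u + y * fr u)).
  set (dN u := db u * (fr u ^ 2 + fi u ^ 2) - db u / b u ^ 2 * (gr u ^ 2 + gi u ^ 2)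
    + 2 * b u * dth u * dot u + 2 / b u * (X u - dth u * dot u)).
  assert (Hcsin : forall u, s <= u <= t -> continuous (fun v => sin (th v)) u).
  { intros u Hu. apply (continuous_comp th sin); [now apply Hcth|apply continuous_sin]. }
  assert (Hccos : forall u, s <= u <= t -> continuous (fun v => cos (th v)) u).
  { intros u Hu. apply (continuous_comp th cos); [now apply Hcth|apply continuous_cos]. }
  apply (gronwall N dN k dk); auto.
  - lra.
  - intros u Hu. unfold N, Rdiv.
    assert (Hcinv : continuous (fun v => / b v) u).
    { apply (continuous_comp b Rinv); [now apply Hcb|].
      apply continuous_Rinv. specialize (Hb u Hu). lra. }
    specialize (Hcsin u Hu). specialize (Hccos u Hu). specialize (Hcb u Hu).
    destruct Y. cont; assumption.
  - intros u Hu. assert (Hu' : 0 < u < 1) by lra. derivs u Hu'.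
    assert (D1 := Hdth u Hu). assert (D2 := Hdb u Hu).
    assert (Hbu : 0 < b u) by (apply Hb; lra).
    unfold N, dN, X, dot, fr, fi, gr, gi.
    assert (Hsc : cos (th u) ^ 2 = 1 - sin (th u) ^ 2) by (rewrite sin2_cos2_pow; ring).
    auto_derive.
    + repeat split; auto; try (eexists; eassumption); lra.
    + use_derive.
      (* A polynomial identity modulo cos^2 = 1 - sin^2: powers of cos are lowered by hand after
         normalisation. *)
      match goal with |- ?l = ?rr => enough (l - rr = 0) by lra end.
      field_simplify; [|lra].
      set (S := sin (th u)) in *. set (Cc := cos (th u)) in *.
      replace (Cc ^ 6) with ((Cc ^ 2) ^ 3) by ring.
      replace (Cc ^ 5) with ((Cc ^ 2) ^ 2 * Cc) by ring.
      replace (Cc ^ 4) with ((Cc ^ 2) ^ 2) by ring.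
      replace (Cc ^ 3) with (Cc ^ 2 * Cc) by ring.
      rewrite !Hsc. field. lra.
  - intros u Hu.
    assert (Hbu : 0 < b u) by (apply Hb; lra).
    specialize (Hrate u Hu). specialize (Hm u Hu).
    assert (Hdot : Rabs (dot u) <= N u / 2).
    { assert (H := abs_dot_le (fr u) (fi u) (gr u) (gi u) (b u) Hbu). exact H. }
    assert (HX : Rabs (X u) <= r * N u / 2).
    { assert (H := abs_re_mul_le x y r (gr u) (gi u) (fr u) (fi u) (/ b u) Hr Hxy
        ltac:(apply Rinv_0_lt_compat; lra)).
      replace (/ b u * (gr u ^ 2 + gi u ^ 2) + (fr u ^ 2 + fi u ^ 2) / / b u) with (N u) in H
        by (unfold N, fr, fi, gr, gi; field; lra).
      exact H. }
    assert (HF : 0 <= b u * (fr u ^ 2 + fi u ^ 2)).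
    { apply Rmult_le_pos; [lra|]. apply Rplus_le_le_0_compat; apply pow2_ge_0. }
    assert (HG : 0 <= (gr u ^ 2 + gi u ^ 2) / b u).
    { apply Rdiv_le_0_compat; [|lra]. apply Rplus_le_le_0_compat; apply pow2_ge_0. }
    assert (HN : N u = b u * (fr u ^ 2 + fi u ^ 2) + (gr u ^ 2 + gi u ^ 2) / b u)
      by reflexivity.
    assert (Hdd : Rabs (dth u * dot u) <= m u * (N u / 2)).
    { rewrite Rabs_mult. apply Rmult_le_compat; auto using Rabs_pos. }
    apply Rabs_le_between in Hdd. apply Rabs_le_between in HX.
    assert (Hib : 0 < / b u) by (apply Rinv_0_lt_compat; lra).
    apply Rle_trans with ((Rabs (db u) / b u + b u * m u + (r + m u) / b u) * N u).
    2:{ apply Rmult_le_compat_r; lra. }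
    assert (T1 : db u * (fr u ^ 2 + fi u ^ 2) - db u / b u ^ 2 * (gr u ^ 2 + gi u ^ 2)
              <= Rabs (db u) / b u * N u).
    { replace (db u * (fr u ^ 2 + fi u ^ 2) - db u / b u ^ 2 * (gr u ^ 2 + gi u ^ 2))
        with (db u / b u * (b u * (fr u ^ 2 + fi u ^ 2))
              + (- db u) / b u * ((gr u ^ 2 + gi u ^ 2) / b u)) by (field; lra).
      replace (Rabs (db u) / b u * N u)
        with (Rabs (db u) / b u * (b u * (fr u ^ 2 + fi u ^ 2))
              + Rabs (db u) / b u * ((gr u ^ 2 + gi u ^ 2) / b u)) by (rewrite HN; ring).
      apply Rplus_le_compat; apply Rmult_le_compat_r; auto; unfold Rdiv;
        apply Rmult_le_compat_r; try lra.
      - apply Rle_abs.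
      - rewrite <- Rabs_Ropp. apply Rle_abs. }
    assert (T2 : 2 * b u * dth u * dot u <= b u * m u * N u).
    { replace (2 * b u * dth u * dot u) with (2 * b u * (dth u * dot u)) by ring.
      replace (b u * m u * N u) with (2 * b u * (m u * (N u / 2))) by field.
      apply Rmult_le_compat_l; lra. }
    assert (T3 : 2 / b u * (X u - dth u * dot u) <= (r + m u) / b u * N u).
    { replace ((r + m u) / b u * N u) with (2 / b u * (r * N u / 2 + m u * (N u / 2)))
        by (field; lra).
      apply Rmult_le_compat_l; [|lra]. apply Rdiv_le_0_compat; lra. }
    unfold dN. lra.
Qed.

End UpperBound.

(** * The rows of the fundamental solution *)

Definition dphi (gam bet t : R) : R :=
  Rpower t gam / t * (gam * sin (Rpower t (- bet))
                      - bet * Rpower t (- bet) * cos (Rpower t (- bet))).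

Lemma is_derive_Rpower (e t : R) : 0 < t ->
  is_derive (fun u => Rpower u e) t (e * Rpower t e / t).
Proof.
  intros Ht. unfold Rpower. auto_derive; [exact Ht|]. field. lra.
Qed.

Lemma is_derive_phi (gam bet t : R) : 0 < t -> is_derive (phi gam bet) t (dphi gam bet t).
Proof.
  intros Ht. unfold phi, dphi.
  assert (D1 := is_derive_Rpower gam t Ht). assert (D2 := is_derive_Rpower (- bet) t Ht).
  auto_derive.
  - repeat split; eexists; eassumption.
  - use_derive. field. lra.
Qed.

Lemma continuous_phi (gam bet t : R) : 0 < t -> continuous (phi gam bet) t.
Proof.
  intros Ht. apply (ex_derive_continuous (phi gam bet)).
  exists (dphi gam bet t). now apply is_derive_phi.
Qed.

Lemma continuous_Hmat (gam bet t : R) (i j : nat) : 0 < t ->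
  continuous (fun u => Hmat gam bet u i j) t.
Proof.
  intros Ht. assert (Hc := continuous_phi gam bet t Ht).
  assert (Hx : forall i, continuous (fun u => xi (phi gam bet u) i) t).
  { intros l. unfold xi. destruct (Nat.eqb l 0).
    - apply (continuous_comp (phi gam bet) cos); [exact Hc|apply continuous_cos].
    - apply (continuous_comp (phi gam bet) sin); [exact Hc|apply continuous_sin]. }
  unfold Hmat. apply continuous_Rmult; apply Hx.
Qed.

Lemma is_RInt_C (f : R -> C) (a b : R) (v : C) :
  is_RInt (V := C_R_CompleteNormedModule) f a b v ->
  is_RInt (V := R_NormedModule) (fun t => fst (f t)) a b (fst v) /\
  is_RInt (V := R_NormedModule) (fun t => snd (f t)) a b (snd v).
Proof.
  intros Hf. split.
  - exact (is_RInt_fct_extend_fst (U := R_NormedModule) (V := R_NormedModule) f a b v Hf).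
  - exact (is_RInt_fct_extend_snd (U := R_NormedModule) (V := R_NormedModule) f a b v Hf).
Qed.

Section Fundamental.
Context {gam bet : R}.
Let H := Hmat gam bet.

(* At z = 0 the fundamental solution is constant, so its integral equation
   says that H is Riemann integrable. *)
Lemma ex_RInt_Hmat (W : R -> nat -> nat -> C) (i j : nat) (t : R) :
  is_fund_sol H 0%C W -> (i < 2)%nat -> (j < 2)%nat -> 0 <= t <= 1 ->
  ex_RInt (fun u => H u i j) 0 t.
Proof.
  intros [_ HW] Hi Hj Ht.
  assert (HWI : forall s, 0 <= s <= 1 -> W s i 0%nat = RtoC (Imat i 0) /\
                                       W s i 1%nat = RtoC (Imat i 1)).
  { intros s Hs.
    destruct (HW s Hs i 0%nat Hi ltac:(lia)) as [v0 [_ E0]].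
    destruct (HW s Hs i 1%nat Hi ltac:(lia)) as [v1 [_ E1]].
    destruct (W s i 0%nat) as [a b]. destruct (W s i 1%nat) as [a' b'].
    unfold Jmat, Cplus, Cmult, RtoC in E0, E1. simpl in E0, E1.
    injection E0; injection E1; intros.
    destruct i as [|[|i]]; [| |lia]; unfold Imat, RtoC; simpl in *;
      split; f_equal; lra. }
  destruct (HW t Ht i j Hi Hj) as [v [Hv _]].
  apply is_RInt_C in Hv. destruct Hv as [Hv _].
  exists (fst v). refine (is_RInt_ext _ _ _ _ _ _ Hv).
  intros s Hs. rewrite Rmin_left, Rmax_right in Hs by lra.
  destruct (HWI s ltac:(lra)) as [-> ->].
  destruct i as [|[|i]]; [| |lia]; unfold Imat; simpl; ring.
Qed.

Lemma gram_exists (W : R -> nat -> nat -> C) : is_fund_sol H 0%C W ->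
  exists P11 P12 P22, gram (phi gam bet) P11 P12 P22 /\
    forall s t, 0 <= s <= t -> t <= 1 -> detOmega H s t = gdet P11 P12 P22 s t.
Proof.
  intros HW.
  destruct (primitive_01 (fun u => H u 0%nat 0%nat)) as (P11 & C1 & I1 & D1).
  { intros t Ht. apply (ex_RInt_Hmat W); auto; lia. }
  destruct (primitive_01 (fun u => H u 0%nat 1%nat)) as (P12 & C2 & I2 & D2).
  { intros t Ht. apply (ex_RInt_Hmat W); auto; lia. }
  destruct (primitive_01 (fun u => H u 1%nat 1%nat)) as (P22 & C3 & I3 & D3).
  { intros t Ht. apply (ex_RInt_Hmat W); auto; lia. }
  exists P11, P12, P22. split.
  - split; auto; intros t Ht.
    + replace (cos (phi gam bet t) ^ 2) with (H t 0%nat 0%nat)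
        by (unfold H, Hmat, xi; simpl; ring).
      apply D1; [exact Ht|]. apply continuous_Hmat. lra.
    + apply D2; [exact Ht|]. apply continuous_Hmat. lra.
    + replace (sin (phi gam bet t) ^ 2) with (H t 1%nat 1%nat)
        by (unfold H, Hmat, xi; simpl; ring).
      apply D3; [exact Ht|]. apply continuous_Hmat. lra.
  - intros s t Hs Ht.
    assert (Hgen : forall (f F : R -> R), (forall t, 0 <= t <= 1 -> is_RInt f 0 t (F t)) ->
        RInt f s t = F t - F s).
    { intros f F HF. apply is_RInt_unique.
      replace (F t - F s) with (plus (opp (F s)) (F t)) by (unfold plus, opp; simpl; ring).
      apply (is_RInt_Chasles f s 0 t); [|apply HF; lra].
      apply (is_RInt_swap (V := R_NormedModule) f s 0 (F s)), HF. lra. }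
    unfold detOmega, Omega, gdet.
    rewrite (Hgen _ _ I1), (Hgen _ _ I2), (Hgen _ _ I3).
    rewrite (RInt_ext (fun u => H u 1%nat 0%nat) (fun u => H u 0%nat 1%nat)).
    + rewrite (Hgen _ _ I2). ring.
    + intros u _. apply Rmult_comm.
Qed.

(** A bootstrap: the integral equation identifies the entries on [0, 1] with combinations of
    primitives, so they are continuous; then the integrand is continuous in (0, 1) and the
    primitives are differentiable there. Since column 0 of W J is the second column of W and column
    1 is minus the first, [F0], [G0] yield p2, q2 and [F1], [G1] yield p1, q1. *)
Lemma row_exists (z : C) (W : R -> nat -> nat -> C) (i : nat) :
  is_fund_sol H z W -> (i < 2)%nat ->
  exists p1 q1 p2 q2, rowsol (phi gam bet) (fst z) (snd z) p1 q1 p2 q2 /\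
    forall t, 0 <= t <= 1 -> W t i 0%nat = (p1 t, q1 t) /\ W t i 1%nat = (p2 t, q2 t).
Proof.
  intros [_ HW] Hi. destruct z as [x y]. simpl.
  set (g j s := (W s i 0%nat * RtoC (H s 0%nat j) + W s i 1%nat * RtoC (H s 1%nat j))%C) in HW.
  assert (Hprim : forall j, (j < 2)%nat -> exists F G : R -> R,
    (forall t, continuous F t) /\ (forall t, continuous G t) /\
    (forall t, 0 <= t <= 1 ->
      (W t i 0%nat * RtoC (Jmat 0%nat j) + W t i 1%nat * RtoC (Jmat 1%nat j))%C
        = (RtoC (Jmat i j) + (x, y) * (F t, G t))%C) /\
    (forall t, 0 < t < 1 -> continuous (fun s => fst (g j s)) t ->
       is_derive F t (fst (g j t))) /\
    (forall t, 0 < t < 1 -> continuous (fun s => snd (g j s)) t ->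
       is_derive G t (snd (g j t)))).
  { intros j Hj.
    destruct (primitive_01 (fun s => fst (g j s))) as (F & CF & IF & DF).
    { intros t Ht. destruct (HW t Ht i j Hi Hj) as [v [Hv _]].
      exists (fst v). exact (proj1 (is_RInt_C _ _ _ _ Hv)). }
    destruct (primitive_01 (fun s => snd (g j s))) as (G & CG & IG & DG).
    { intros t Ht. destruct (HW t Ht i j Hi Hj) as [v [Hv _]].
      exists (snd v). exact (proj2 (is_RInt_C _ _ _ _ Hv)). }
    exists F, G. do 2 (split; [assumption|]). split; [|split; assumption].
    intros t Ht. destruct (HW t Ht i j Hi Hj) as [v [Hv ->]].
    destruct (is_RInt_C _ _ _ _ Hv) as [H1 H2].
    assert (J1 := is_RInt_unique (V := R_CompleteNormedModule) _ _ _ _ H1).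
    assert (J2 := is_RInt_unique (V := R_CompleteNormedModule) _ _ _ _ H2).
    assert (J3 := is_RInt_unique (V := R_CompleteNormedModule) _ _ _ _ (IF t Ht)).
    assert (J4 := is_RInt_unique (V := R_CompleteNormedModule) _ _ _ _ (IG t Ht)).
    rewrite <- J3, <- J4. unfold g. rewrite J1, J2. destruct v; reflexivity. }
  destruct (Hprim 0%nat ltac:(lia)) as (F0 & G0 & CF0 & CG0 & E0 & DF0 & DG0).
  destruct (Hprim 1%nat ltac:(lia)) as (F1 & G1 & CF1 & CG1 & E1 & DF1 & DG1).
  set (p1 t := - (Jmat i 1 + (x * F1 t - y * G1 t))).
  set (q1 t := - (x * G1 t + y * F1 t)).
  set (p2 t := Jmat i 0 + (x * F0 t - y * G0 t)).
  set (q2 t := x * G0 t + y * F0 t).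
  assert (HWpq : forall t, 0 <= t <= 1 ->
    W t i 0%nat = (p1 t, q1 t) /\ W t i 1%nat = (p2 t, q2 t)).
  { intros t Ht. specialize (E0 t Ht). specialize (E1 t Ht).
    destruct (W t i 0%nat) as [a b]. destruct (W t i 1%nat) as [a' b'].
    unfold Cplus, Cmult, RtoC in E0, E1.
    injection E0; injection E1; intros K1 K2 K3 K4.
    cbn [Jmat fst snd] in K1, K2, K3, K4.
    unfold p1, q1, p2, q2. split; f_equal; lra. }
  assert (Cp1 : forall t, continuous p1 t) by (intros t; unfold p1; cont).
  assert (Cq1 : forall t, continuous q1 t) by (intros t; unfold q1; cont).
  assert (Cp2 : forall t, continuous p2 t) by (intros t; unfold p2; cont).
  assert (Cq2 : forall t, continuous q2 t) by (intros t; unfold q2; cont).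
  assert (Hg : forall j s, 0 <= s <= 1 -> g j s =
    (p1 s * H s 0%nat j + p2 s * H s 1%nat j, q1 s * H s 0%nat j + q2 s * H s 1%nat j)).
  { intros j s Hs. unfold g. destruct (HWpq s Hs) as [-> ->].
    unfold Cplus, Cmult, RtoC. simpl. f_equal; ring. }
  assert (Hcg : forall j t, 0 < t < 1 ->
    continuous (fun s => fst (g j s)) t /\ continuous (fun s => snd (g j s)) t).
  { intros j t Ht.
    assert (K0 := continuous_Hmat gam bet t 0 j ltac:(lra)).
    assert (K1 := continuous_Hmat gam bet t 1 j ltac:(lra)).
    split.
    - apply (continuous_ext_loc _
        (fun s => p1 s * Hmat gam bet s 0%nat j + p2 s * Hmat gam bet s 1%nat j)).
      + apply (filter_imp (fun s => 0 < s < 1)); [|now apply locally_Ioo].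
        intros s Hs. rewrite Hg by lra. reflexivity.
      + cont; assumption.
    - apply (continuous_ext_loc _
        (fun s => q1 s * Hmat gam bet s 0%nat j + q2 s * Hmat gam bet s 1%nat j)).
      + apply (filter_imp (fun s => 0 < s < 1)); [|now apply locally_Ioo].
        intros s Hs. rewrite Hg by lra. reflexivity.
      + cont; assumption. }
  exists p1, q1, p2, q2. split; [|exact HWpq].
  assert (HD : forall t, 0 < t < 1 ->
    is_derive F0 t (fst (g 0%nat t)) /\ is_derive G0 t (snd (g 0%nat t)) /\
    is_derive F1 t (fst (g 1%nat t)) /\ is_derive G1 t (snd (g 1%nat t))).
  { intros t Ht. destruct (Hcg 0%nat t Ht). destruct (Hcg 1%nat t Ht). auto. }
  split; auto; intros t Ht; destruct (HD t Ht) as (D1 & D2 & D3 & D4);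
    rewrite (Hg 0%nat t) in D1, D2 by lra; rewrite (Hg 1%nat t) in D3, D4 by lra;
    unfold H, Hmat, xi in D1, D2, D3, D4; cbn [fst snd Nat.eqb] in D1, D2, D3, D4;
    set (c := cos (phi gam bet t)) in *; set (s := sin (phi gam bet t)) in *.
  - apply (is_derive_ext_loc (fun t => - (Jmat i 1 + (x * F1 t - y * G1 t)))).
    + now apply filter_forall.
    + clearbody p1 q1 p2 q2. derive_tac.
  - apply (is_derive_ext_loc (fun t => - (x * G1 t + y * F1 t))).
    + now apply filter_forall.
    + clearbody p1 q1 p2 q2. derive_tac.
  - apply (is_derive_ext_loc (fun t => Jmat i 0 + (x * F0 t - y * G0 t))).
    + now apply filter_forall.
    + clearbody p1 q1 p2 q2. derive_tac.
  - apply (is_derive_ext_loc (fun t => x * G0 t + y * F0 t)).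
    + now apply filter_forall.
    + clearbody p1 q1 p2 q2. derive_tac.
Qed.

End Fundamental.

(** * Packings *)

Lemma abs_sin_le_abs (x : R) : Rabs (sin x) <= Rabs x.
Proof.
  assert (Hpos : forall x, 0 <= x -> Rabs (sin x) <= x).
  { clear x. intros x [Hx| <-]; [|rewrite sin_0, Rabs_R0; lra].
    assert (H1 : sin x < x) by now apply sin_lt_x.
    apply Rabs_le. split; [|lra].
    destruct (Rle_dec 1 x).
    + assert (H := SIN_bound x). lra.
    + assert (0 <= sin x); [|lra]. apply sin_ge_0; [lra|]. assert (HP := PI2_1). lra. }
  destruct (Rle_dec 0 x) as [H|H].
  - rewrite (Rabs_right x) by lra. now apply Hpos.
  - rewrite (Rabs_left x), <- Rabs_Ropp, <- sin_neg by lra. apply Hpos. lra.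
Qed.

Lemma cos_ge_half (x : R) : 0 <= x <= 1 -> 1 / 2 <= cos x.
Proof.
  intros Hx.
  replace (cos x) with (1 - 2 * sin (x / 2) * sin (x / 2)).
  2:{ rewrite <- cos_2a_sin. f_equal. field. }
  assert (H1 := abs_sin_le_abs (x / 2)).
  rewrite (Rabs_right (x / 2)) in H1 by lra. apply Rabs_le_between in H1. nra.
Qed.

Lemma sin_sqr_lower (d : R) : Rabs d <= 1 -> d ^ 2 / 4 <= sin d ^ 2.
Proof.
  assert (Hpos : forall d, 0 <= d <= 1 -> d / 2 <= sin d).
  { clear d. intros d Hd.
    assert (H := nondecreasing_of_derive (fun u => sin u - u / 2) (fun u => cos u - 1 / 2) 0 d).
    enough (sin 0 - 0 / 2 <= sin d - d / 2) by (rewrite sin_0 in *; lra).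
    apply H; [lra| | |].
    - intros u _. apply (ex_derive_continuous (fun u => sin u - u / 2)).
      auto_derive. exact I.
    - intros u _. auto_derive; [exact I|field].
    - intros u Hu.
      assert (H1 := cos_ge_half u ltac:(lra)). lra. }
  intros Hd. rewrite <- (pow2_abs d).
  assert (Hs : sin (Rabs d) ^ 2 = sin d ^ 2).
  { unfold Rabs. destruct (Rcase_abs d); [rewrite sin_neg; ring|reflexivity]. }
  rewrite <- Hs.
  assert (H1 := Hpos (Rabs d) (conj (Rabs_pos d) Hd)).
  assert (H2 := Rabs_pos d). nra.
Qed.

(* Gaps between the intervals of a packing are absorbed into the intervals: for a Gram
   determinant D this costs nothing, since D is monotone in the interval. *)
Inductive pack (D : R -> R -> R) (e : R) : R -> R -> nat -> Prop :=
| pack_nil a b : a <= b -> pack D e a b 0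
| pack_cons a x b n : a <= x -> e < D a x -> pack D e x b n -> pack D e a b (S n).

Lemma pack_le (D : R -> R -> R) (e a b : R) (n : nat) : pack D e a b n -> a <= b.
Proof. intros H. induction H; lra. Qed.

Section Packing.
Context {th P11 P12 P22 : R -> R} (G : gram th P11 P12 P22).
Let D := gdet P11 P12 P22.

Lemma pack_extend_left (e a a' b : R) (n : nat) : 0 <= a' <= a -> b <= 1 ->
  pack D e a b n -> pack D e a' b n.
Proof.
  intros Ha Hb H. destruct H as [a b Hab|a x b n Hax He H].
  - apply pack_nil. lra.
  - assert (Hx := pack_le _ _ _ _ _ H).
    apply pack_cons with x; [lra| |exact H].
    apply Rlt_le_trans with (1 := He). apply (gdet_mono G); lra.
Qed.

Lemma pack_app (e a b b' d : R) (n m : nat) : 0 <= a -> b <= b' -> d <= 1 ->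
  pack D e a b n -> pack D e b' d m -> pack D e a d (n + m).
Proof.
  intros Ha Hb Hd H1 H2. assert (Hbd := pack_le _ _ _ _ _ H2).
  induction H1 as [a b Hab|a x b n Hax He H IH].
  - simpl. apply pack_extend_left with b'; auto; lra.
  - simpl. apply pack_cons with x; auto. apply IH; lra.
Qed.

(* By monotonicity of D, sigma_j never overtakes the end of the j-th interval. *)
Lemma pack_greedy (e : R) (k : nat) (sigma : nat -> R) :
  (1 <= k)%nat -> sigma 0%nat = 0 ->
  (forall j, (1 <= j < k)%nat ->
     sigma (j - 1)%nat < sigma j < 1 /\ D (sigma (j - 1)%nat) (sigma j) = e) ->
  D (sigma (k - 1)%nat) 1 <= e ->
  forall a b n, pack D e a b n -> b <= 1 ->
  forall j, (j < k)%nat -> 0 <= sigma j <= a -> (j + n < k)%nat.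
Proof.
  intros Hk H0 Hsig Hlast a b n H.
  induction H as [a b Hab|a x b n Hax He H IH]; intros Hb j Hj Hja; [lia|].
  assert (Hx := pack_le _ _ _ _ _ H).
  assert (He' : e < D (sigma j) x).
  { apply Rlt_le_trans with (1 := He). apply (gdet_mono G); lra. }
  assert (Hne : j <> (k - 1)%nat).
  { intros ->. assert (D (sigma (k - 1)%nat) x <= D (sigma (k - 1)%nat) 1).
    { apply (gdet_mono G); lra. }
    lra. }
  replace (j + S n)%nat with (S j + n)%nat by lia.
  destruct (Hsig (S j) ltac:(lia)) as [H1 H2].
  replace (S j - 1)%nat with j in H1, H2 by lia.
  apply IH; [lra|lia|]. split; [lra|].
  apply Rnot_lt_le. intros Hlt.
  assert (D (sigma j) x <= D (sigma j) (sigma (S j))) by (apply (gdet_mono G); lra).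
  lra.
Qed.

(** The derivative of det Omega(s, .) at u is the integral of sin^2 (th v - th u) over v in [s, u].
    As M (t - s) <= 1, the angles differ by at most 1, so the integrand is at least mu^2 (u - v)^2 /
    4. Integrating twice gives mu^2 (u - s)^3 / 12 and then the constant 1/48. *)
Lemma gdet_lower (mu M s t : R) : 0 <= s <= t -> t <= 1 -> 0 <= mu ->
  (forall u v, s < u <= v -> v < t ->
     mu * (v - u) <= Rabs (th v - th u) <= M * (v - u)) ->
  M * (t - s) <= 1 ->
  mu ^ 2 * (t - s) ^ 4 / 48 <= D s t.
Proof.
  intros Hs Ht Hmu Hlip HM.
  enough (D s s - mu ^ 2 * (s - s) ^ 4 / 48 <= D s t - mu ^ 2 * (t - s) ^ 4 / 48).
  { assert (E : D s s = 0) by (unfold D, gdet; ring). rewrite E in *. lra. }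
  apply (nondecreasing_of_derive (fun u => D s u - mu ^ 2 * (u - s) ^ 4 / 48)
    (fun u => cos (th u) ^ 2 * (P22 u - P22 s)
              - 2 * cos (th u) * sin (th u) * (P12 u - P12 s)
              + sin (th u) ^ 2 * (P11 u - P11 s) - mu ^ 2 * (u - s) ^ 3 / 12)).
  - lra.
  - intros u _. unfold D, gdet, Rdiv. destruct G. cont.
  - intros u Hu. assert (E := gdet_derive G s u ltac:(lra)).
    apply (is_derive_minus (D s) (fun u => mu ^ 2 * (u - s) ^ 4 / 48)); [exact E|].
    auto_derive; [exact I|field].
  - intros u Hu.
    (* The inner integration, in v with u fixed: E u - E s is the derivative whose sign is
       wanted. *)
    set (E v := cos (th u) ^ 2 * P22 v - 2 * cos (th u) * sin (th u) * P12 v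
                + sin (th u) ^ 2 * P11 v + mu ^ 2 * (u - s) ^ 3 / 12
                - mu ^ 2 * ((u - s) ^ 3 - (u - v) ^ 3) / 12).
    enough (E s <= E u) by (unfold E in *; lra).
    apply (nondecreasing_of_derive E
      (fun v => sin (th v - th u) ^ 2 - mu ^ 2 * (u - v) ^ 2 / 4)).
    + lra.
    + intros v _. unfold E, Rdiv. destruct G. cont.
    + intros v Hv. assert (Hv' : 0 < v < 1) by lra.
      assert (D1 := gram_d11 _ _ _ _ G v Hv').
      assert (D2 := gram_d12 _ _ _ _ G v Hv').
      assert (D3 := gram_d22 _ _ _ _ G v Hv').
      unfold E. derive_tac. rewrite sin_minus. field.
    + intros v Hv. destruct (Hlip v u ltac:(lra) ltac:(lra)) as [L1 L2].
      rewrite Rabs_minus_sym in L1, L2.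
      assert (HS := sin_sqr_lower (th v - th u)).
      assert (Hle1 : Rabs (th v - th u) <= 1).
      { apply Rle_trans with (1 := L2). apply Rle_trans with (2 := HM).
        assert (0 <= M).
        { assert (0 <= M * (u - v)) by (apply Rle_trans with (2 := L2); apply Rabs_pos).
          apply Rmult_le_reg_r with (u - v); lra. }
        apply Rmult_le_compat_l; lra. }
      specialize (HS Hle1).
      assert ((mu * (u - v)) ^ 2 <= Rabs (th v - th u) ^ 2).
      { apply pow_incr. split; [apply Rmult_le_pos; lra|exact L1]. }
      rewrite pow2_abs in H. lra.
Qed.

Lemma pack_equal (mu M A B l e : R) :
  0 <= A -> B <= 1 -> 0 <= mu ->
  (forall u v, A < u <= v -> v < B ->
     mu * (v - u) <= Rabs (th v - th u) <= M * (v - u)) ->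
  0 < l -> M * l <= 1 -> e < mu ^ 2 * l ^ 4 / 48 ->
  forall n a, A <= a -> a + INR n * l <= B -> pack D e a (a + INR n * l) n.
Proof.
  intros HA HB Hmu Hlip Hl HM He.
  induction n as [|n IH]; intros a Ha Hb.
  - simpl. apply pack_nil. lra.
  - assert (0 <= INR n * l) by (apply Rmult_le_pos; [apply pos_INR|lra]).
    rewrite S_INR in *.
    replace (a + (INR n + 1) * l) with (a + l + INR n * l) in * by ring.
    apply pack_cons with (a + l); [lra| |apply IH; lra].
    apply Rlt_le_trans with (1 := He).
    assert (HL := gdet_lower mu M a (a + l)).
    replace (a + l - a) with l in HL by ring.
    apply HL; try lra.
    intros u v Hu Hv. apply Hlip; lra.
Qed.

(** The interval is cut into n equal pieces of length l with q <= l sqrt (r mu) <= 2 q for q = 1 +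
    96 c. By [gdet_lower] each piece has det Omega >= q^4 / (48 r^2) >= 2 c / r^2, the factor 2
    making it strict; the last hypothesis gives M l <= 1. *)
Lemma pack_interval (mu M A B c r : R) :
  0 <= A -> B <= 1 -> 0 < mu -> 0 < c -> 0 < r ->
  (forall u v, A < u <= v -> v < B ->
     mu * (v - u) <= Rabs (th v - th u) <= M * (v - u)) ->
  1 + 96 * c <= (B - A) * sqrt (r * mu) ->
  0 <= M -> (2 * (1 + 96 * c) * M) ^ 2 <= r * mu ->
  exists n, pack D (c / r ^ 2) A B n /\
    (B - A) * sqrt (r * mu) / (2 * (1 + 96 * c)) <= INR n.
Proof.
  intros HA HB Hmu Hc Hr Hlip HL HM0 HM.
  set (q := 1 + 96 * c) in *. assert (Hq : 1 <= q) by (unfold q; lra).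
  assert (Hrm : 0 < r * mu) by (now apply Rmult_lt_0_compat).
  set (k := sqrt (r * mu)) in *.
  assert (Hk : 0 < k) by now apply sqrt_lt_R0.
  assert (Hk2 : k ^ 2 = r * mu) by (apply pow2_sqrt; lra).
  set (X := (B - A) * k / q).
  assert (HX : 1 <= X).
  { unfold X. apply Rmult_le_reg_r with q; [lra|].
    replace ((B - A) * k / q * q) with ((B - A) * k) by (field; lra). lra. }
  destruct (nfloor_ex X ltac:(lra)) as [n [Hn1 Hn2]].
  assert (Hn : 1 <= INR n).
  { destruct n as [|n]; [simpl in Hn2; lra|]. rewrite S_INR. assert (H := pos_INR n). lra. }
  assert (Hn3 : X / 2 <= INR n) by lra.
  exists n. split.
  2:{ replace ((B - A) * k / (2 * q)) with (X / 2) by (unfold X; field; lra). exact Hn3. }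
  set (l := (B - A) / INR n).
  assert (HBA : 0 < B - A).
  { apply Rmult_lt_reg_r with k; [exact Hk|]. lra. }
  assert (Hl : 0 < l) by (apply Rdiv_lt_0_compat; lra).
  assert (HBAl : B - A = INR n * l) by (unfold l; field; lra).
  assert (HXk : X * q = INR n * l * k) by (unfold X; rewrite <- HBAl; field; lra).
  assert (Hlk1 : q <= l * k).
  { apply Rmult_le_reg_l with (INR n); [lra|].
    replace (INR n * (l * k)) with (X * q) by (rewrite HXk; ring).
    apply Rmult_le_compat_r; lra. }
  assert (Hlk2 : l * k <= 2 * q).
  { apply Rmult_le_reg_l with (INR n); [lra|].
    replace (INR n * (l * k)) with (X * q) by (rewrite HXk; ring).
    replace (INR n * (2 * q)) with (2 * INR n * q) by ring.
    apply Rmult_le_compat_r; lra. }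
  replace B with (A + INR n * l) by lra.
  apply (pack_equal mu M A B); try lra; auto.
  - assert (HMk : 2 * q * M <= k).
    { apply Rsqr_incr_0_var; [|lra]. rewrite !Rsqr_pow2, Hk2. exact HM. }
    apply Rmult_le_reg_r with k; [exact Hk|].
    replace (M * l * k) with (M * (l * k)) by ring.
    apply Rle_trans with (M * (2 * q)); [apply Rmult_le_compat_l; lra|lra].
  - assert (Hq4 : 96 * c <= q ^ 4).
    { assert (q ^ 1 <= q ^ 4) by (apply Rle_pow; [exact Hq|lia]). unfold q in *. lra. }
    assert (Hlk4 : q ^ 4 <= (l * k) ^ 4) by (apply pow_incr; lra).
    replace (mu ^ 2 * l ^ 4 / 48) with ((l * k) ^ 4 / 48 / r ^ 2).
    2:{ replace ((l * k) ^ 4) with (l ^ 4 * (k ^ 2) ^ 2) by ring. rewrite Hk2. field. lra. }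
    unfold Rdiv at 1 2. apply Rmult_lt_compat_r; [apply Rinv_0_lt_compat, pow_lt; lra|lra].
Qed.

End Packing.

(** * Size of the rows at [1] *)

Lemma Rpower_pos (x e : R) : 0 < Rpower x e.
Proof. apply exp_pos. Qed.

Lemma exp_le_compat (a b : R) : a <= b -> exp a <= exp b.
Proof. intros [H| ->]; [left; now apply exp_increasing|lra]. Qed.

Lemma Rpower_le_exp_small (x e1 e2 : R) : 0 < x <= 1 -> e1 <= e2 -> Rpower x e2 <= Rpower x e1.
Proof.
  intros Hx He. apply exp_le_compat.
  assert (ln x <= 0) by (rewrite <- ln_1; apply ln_le; lra). nra.
Qed.

Lemma Rpower_le_base_neg (x y e : R) : 0 < x <= y -> 0 <= e -> Rpower y (- e) <= Rpower x (- e).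
Proof.
  intros Hx He. apply exp_le_compat.
  assert (ln x <= ln y) by (apply ln_le; lra). nra.
Qed.

Lemma Rpower_inv_exp (r q e : R) : 0 < r -> Rpower (Rpower r (- / q)) e = Rpower r (- e / q).
Proof. intros Hr. rewrite Rpower_mult. f_equal. unfold Rdiv. ring. Qed.

Lemma Rpower_one (e : R) : Rpower 1 e = 1.
Proof. unfold Rpower. rewrite ln_1, Rmult_0_r. apply exp_0. Qed.

Lemma Rpower_le_1 (x e : R) : 1 <= x -> 0 <= e -> Rpower x (- e) <= 1.
Proof.
  intros Hx He. rewrite <- (Rpower_one (- e)). apply Rpower_le_base_neg; lra.
Qed.

(** Estimating sin x by x = t^(-bet) instead of by 1 gives both terms of phi' the factor t^(-bet);
    this matters for bet <= 0, where x is at most 1 on (0, 1]. *)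
Lemma dphi_upper (gam bet t : R) : 0 < t ->
  Rabs (dphi gam bet t) <= (Rabs gam + Rabs bet) * Rpower t (- (bet + 1 - gam)).
Proof.
  intros Ht. unfold dphi.
  set (x := Rpower t (- bet)). assert (Hx : 0 < x) by apply Rpower_pos.
  assert (Hg : 0 < Rpower t gam / t) by (apply Rdiv_lt_0_compat; [apply Rpower_pos|lra]).
  rewrite Rabs_mult, (Rabs_right (Rpower t gam / t)) by lra.
  replace (Rpower t (- (bet + 1 - gam))) with (Rpower t gam / t * x).
  2:{ unfold x. rewrite <- (Rpower_1 t) at 2 by lra. unfold Rdiv.
      rewrite <- Rpower_Ropp, <- !Rpower_plus. f_equal. ring. }
  replace ((Rabs gam + Rabs bet) * (Rpower t gam / t * x))
    with (Rpower t gam / t * (Rabs gam * x + Rabs bet * x)) by ring.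
  apply Rmult_le_compat_l; [lra|].
  unfold Rminus. apply Rle_trans with (1 := Rabs_triang _ _).
  rewrite Rabs_Ropp, !Rabs_mult, (Rabs_right x) by lra.
  apply Rplus_le_compat.
  - apply Rmult_le_compat_l; [apply Rabs_pos|].
    assert (H := abs_sin_le_abs x). rewrite (Rabs_right x) in H by lra. exact H.
  - rewrite <- (Rmult_1_r (Rabs bet * x)) at 2.
    apply Rmult_le_compat_l; [apply Rmult_le_pos; [apply Rabs_pos|lra]|].
    apply Rabs_le, COS_bound.
Qed.

Lemma abs_sin_phi_le (gam bet g t t0 : R) :
  0 <= g -> g = 0 \/ g = gam -> 0 < t <= t0 -> Rabs (sin (phi gam bet t)) <= Rpower t0 g.
Proof.
  intros Hg [-> | ->] Ht.
  - rewrite Rpower_O by lra. apply Rabs_le, SIN_bound.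
  - apply Rle_trans with (1 := abs_sin_le_abs _). unfold phi.
    rewrite Rabs_mult, (Rabs_right (Rpower t gam)) by (left; apply Rpower_pos).
    apply Rle_trans with (Rpower t gam * 1).
    + apply Rmult_le_compat_l; [left; apply Rpower_pos|apply Rabs_le, SIN_bound].
    + rewrite Rmult_1_r. apply Rle_Rpower_l; lra.
Qed.

Definition rownorm2 (p1 q1 p2 q2 : R -> R) (t : R) : R :=
  p1 t ^ 2 + q1 t ^ 2 + p2 t ^ 2 + q2 t ^ 2.

(* [t0 = r^(-1/q)] separates the region of the constant frame (weights 1/a, a) from that of
   the frame rotating with the angle phi, whose weight b = sqrt r * t^(p/2) balances the
   contributions r / b and b |phi'|. *)
Lemma row_upper (gam bet p q g : R) (F : R -> R) :
  p = bet + 1 - gam -> 0 < q -> p <= q -> 0 <= g -> g = 0 \/ g = gam ->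
  (forall u, 0 < u -> is_derive F u (Rpower u (- (p / 2)))) ->
  exists C, forall r x y p1 q1 p2 q2,
    1 <= r -> x ^ 2 + y ^ 2 = r ^ 2 -> rowsol (phi gam bet) x y p1 q1 p2 q2 ->
    rownorm2 p1 q1 p2 q2 0 = 1 ->
    rownorm2 p1 q1 p2 q2 1 <=
      2 * exp (C * ln r + 4 * Rpower r (1 - (1 + g) / q)
           + (2 * (Rabs gam + Rabs bet) + 1) * sqrt r * (F 1 - F (Rpower r (- / q)))).
Proof.
  intros Hp Hq Hpq Hg Hgg HF.
  set (K := Rabs gam + Rabs bet).
  assert (HK : 0 <= K) by (apply Rplus_le_le_0_compat; apply Rabs_pos).
  (* In order: the weight b at 1, the weight b at t0, the weights of the constant frame, and the
     integral of |b'| / b over [t0, 1]. *)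
  exists (1 / 2 + (1 / 2 + Rabs p / (2 * q)) + 2 * g / q + Rabs p / (2 * q)).
  intros r x y p1 q1 p2 q2 Hr Hxy Y H0.
  set (t0 := Rpower r (- / q)). set (a := Rpower t0 g).
  assert (Hiq : 0 < / q) by now apply Rinv_0_lt_compat.
  assert (Hlnr : 0 <= ln r) by (rewrite <- ln_1; apply ln_le; lra).
  assert (Ht0 : 0 < t0 <= 1).
  { split; [apply Rpower_pos|apply Rpower_le_1; lra]. }
  assert (Ha : 0 < a <= 1).
  { split; [apply Rpower_pos|]. rewrite <- (Rpower_O t0) by lra.
    apply Rpower_le_exp_small; lra. }
  assert (Hra : r * a * t0 = Rpower r (1 - (1 + g) / q)).
  { unfold a, t0. rewrite Rpower_inv_exp by lra.
    rewrite <- (Rpower_1 r) at 1 by lra. rewrite <- !Rpower_plus. f_equal. field. lra. }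
  assert (Hr0 : 0 < r) by lra.
  assert (U1 := upper_bound_small_sin Y Hr0 Hxy a t0 Ha ltac:(lra)).
  assert (Hn1 : rownorm2 p1 q1 p2 q2 t0
    <= exp (4 * Rpower r (1 - (1 + g) / q)) * Rpower r (2 * g / q)).
  { replace (4 * r * a * t0) with (4 * (r * a * t0)) in U1 by ring. rewrite Hra in U1.
    specialize (U1 ltac:(intros u Hu; apply abs_sin_phi_le; auto; lra)).
    (* Passing between the weighted and the plain norm costs 1 / a at either end, in all a^(-2) =
       r^(2 g / q). *)
    assert (Hinv : forall A B, 0 <= A -> 0 <= B ->
      a * (A + B) <= A / a + a * B /\ A / a + a * B <= / a * (A + B)).
    { intros A B HA HB.
      assert (H1 : 1 <= / a) by (rewrite <- Rinv_1; apply Rinv_le_contravar; lra).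
      unfold Rdiv. rewrite !Rmult_plus_distr_l, (Rmult_comm A).
      split; apply Rplus_le_compat; try lra; apply Rmult_le_compat_r; lra. }
    destruct (Hinv (p1 t0 ^ 2 + q1 t0 ^ 2) (p2 t0 ^ 2 + q2 t0 ^ 2)) as [K1 _];
      try (apply Rplus_le_le_0_compat; apply pow2_ge_0).
    destruct (Hinv (p1 0 ^ 2 + q1 0 ^ 2) (p2 0 ^ 2 + q2 0 ^ 2)) as [_ K2];
      try (apply Rplus_le_le_0_compat; apply pow2_ge_0).
    replace (p1 0 ^ 2 + q1 0 ^ 2 + (p2 0 ^ 2 + q2 0 ^ 2)) with 1 in K2
      by (unfold rownorm2 in H0; lra).
    set (E := exp (4 * Rpower r (1 - (1 + g) / q))) in *.
    assert (HE : 0 < E) by apply exp_pos.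
    assert (K3 : a * rownorm2 p1 q1 p2 q2 t0 <= E * / a).
    { unfold rownorm2.
      replace (p1 t0 ^ 2 + q1 t0 ^ 2 + p2 t0 ^ 2 + q2 t0 ^ 2)
        with (p1 t0 ^ 2 + q1 t0 ^ 2 + (p2 t0 ^ 2 + q2 t0 ^ 2)) by ring.
      apply Rle_trans with (1 := K1). apply Rle_trans with (1 := U1).
      apply Rmult_le_compat_l; lra. }
    replace (Rpower r (2 * g / q)) with (/ a * / a).
    2:{ unfold a, t0. rewrite Rpower_inv_exp, <- Rpower_Ropp, <- Rpower_plus by lra.
        f_equal. field. lra. }
    apply Rmult_le_reg_l with a; [lra|]. apply Rle_trans with (1 := K3).
    right. field. lra. }
  set (b t := sqrt r * Rpower t (p / 2)).
  assert (Hsr : 0 < sqrt r) by (apply sqrt_lt_R0; lra).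
  assert (Hb : forall u, 0 < b u) by (intros u; apply Rmult_lt_0_compat; [lra|apply Rpower_pos]).
  assert (U2 := upper_bound_rotating Y Hr0 Hxy (dphi gam bet) b
    (fun u => b u * (p / (2 * u))) (fun u => K * Rpower u (- p))
    (fun u => Rabs p / 2 * ln u + (2 * K + 1) * sqrt r * F u)
    (fun u => Rabs p / (2 * u) + (2 * K + 1) * sqrt r * Rpower u (- (p / 2)))
    t0 1 ltac:(lra) ltac:(lra)).
  assert (Hdb : forall u, 0 < u -> is_derive b u (b u * (p / (2 * u)))).
  { intros u Hu. assert (D1 := is_derive_Rpower (p / 2) u Hu). unfold b.
    auto_derive; [repeat split; eexists; eassumption|]. use_derive. field. lra. }
  assert (Hdk : forall u, 0 < u ->
    is_derive (fun u => Rabs p / 2 * ln u + (2 * K + 1) * sqrt r * F u) u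
      (Rabs p / (2 * u) + (2 * K + 1) * sqrt r * Rpower u (- (p / 2)))).
  { intros u Hu. assert (D1 := HF u Hu).
    auto_derive; [repeat split; auto; eexists; eassumption|]. use_derive. field. lra. }
  cbv zeta in U2.
  assert (U3 := U2
    ltac:(intros u Hu; apply continuous_phi; lra)
    ltac:(intros u Hu; apply (ex_derive_continuous b); eexists; apply Hdb; lra)
    ltac:(intros u Hu; apply (ex_derive_continuous
        (fun u => Rabs p / 2 * ln u + (2 * K + 1) * sqrt r * F u)); eexists; apply Hdk; lra)
    ltac:(intros u Hu; apply Hb)
    ltac:(intros u Hu; apply is_derive_phi; lra)
    ltac:(intros u Hu; apply Hdb; lra)
    ltac:(intros u Hu; apply Hdk; lra)
    ltac:(intros u Hu; rewrite Hp; apply dphi_upper; lra)).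
  clear U2.
  assert (Hrate : forall u, t0 < u < 1 ->
    Rabs (b u * (p / (2 * u))) / b u + b u * (K * Rpower u (- p)) + (r + K * Rpower u (- p)) / b u
    <= Rabs p / (2 * u) + (2 * K + 1) * sqrt r * Rpower u (- (p / 2))).
  { intros u Hu. specialize (Hb u).
    (* The cut at t0 enters here: u^(-p) <= r makes the term K u^(-p) / b no larger than b K
       u^(-p). *)
    assert (Hup : Rpower u (- p) <= r).
    { destruct (Rle_dec 0 p) as [Hp0|Hp0].
      - apply Rle_trans with (Rpower t0 (- p)); [apply Rpower_le_base_neg; lra|].
        unfold t0. rewrite Rpower_inv_exp by lra. rewrite <- (Rpower_1 r) at 2 by lra.
        apply Rle_Rpower; [lra|]. apply Rmult_le_reg_r with q; [lra|].
        replace (- - p / q * q) with p by (field; lra). lra.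
      - apply Rle_trans with 1; [|lra]. rewrite <- (Rpower_O u) by lra.
        apply Rpower_le_exp_small; lra. }
    rewrite Rabs_mult, (Rabs_right (b u)) by lra.
    assert (Hpu : Rabs (p / (2 * u)) = Rabs p / (2 * u)).
    { unfold Rdiv. rewrite Rabs_mult, (Rabs_right (/ (2 * u))); [reflexivity|].
      left. apply Rinv_0_lt_compat. lra. }
    rewrite Hpu.
    replace (b u * (Rabs p / (2 * u)) / b u) with (Rabs p / (2 * u)) by (field; lra).
    set (h := Rpower u (- (p / 2))).
    assert (Hh : 0 < h) by apply Rpower_pos.
    assert (Hh2 : Rpower u (- p) = h * h).
    { unfold h. rewrite <- Rpower_plus. f_equal. field. }
    assert (Hbh : b u = sqrt r / h).
    { unfold b, h. rewrite Rpower_Ropp. field. apply Rgt_not_eq, Rpower_pos. }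
    rewrite Hh2 in *. rewrite Hbh.
    assert (Hsq : sqrt r * sqrt r = r) by (apply sqrt_sqrt; lra).
    replace (sqrt r / h * (K * (h * h))) with (K * (sqrt r * h)) by (field; lra).
    replace ((r + K * (h * h)) / (sqrt r / h)) with (sqrt r * h + K * (h * h * h / sqrt r))
      by (generalize dependent (sqrt r); intros w; intros; rewrite <- Hsq; field; lra).
    assert (h * h * h / sqrt r <= sqrt r * h).
    { apply Rmult_le_reg_r with (sqrt r); [lra|].
      replace (h * h * h / sqrt r * sqrt r) with (h * h * h) by (field; lra).
      replace (sqrt r * h * sqrt r) with (sqrt r * sqrt r * h) by ring.
      rewrite Hsq. apply Rmult_le_compat_r; lra. }
    assert (K * (h * h * h / sqrt r) <= K * (sqrt r * h)) by (apply Rmult_le_compat_l; lra).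
    lra. }
  specialize (U3 Hrate). cbv beta in U3. rewrite ln_1, Rmult_0_r, Rplus_0_l in U3.
  assert (Hrot : forall u,
      (p1 u * cos (phi gam bet u) + p2 u * sin (phi gam bet u)) ^ 2 +
      (q1 u * cos (phi gam bet u) + q2 u * sin (phi gam bet u)) ^ 2 +
      ((p2 u * cos (phi gam bet u) - p1 u * sin (phi gam bet u)) ^ 2 +
      (q2 u * cos (phi gam bet u) - q1 u * sin (phi gam bet u)) ^ 2)
      = rownorm2 p1 q1 p2 q2 u).
  { intros u. unfold rownorm2.
    transitivity ((p1 u ^ 2 + p2 u ^ 2 + q1 u ^ 2 + q2 u ^ 2)
      * (sin (phi gam bet u) ^ 2 + cos (phi gam bet u) ^ 2)); [ring|].
    rewrite sin2_cos2_pow. ring. }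
  assert (R0 := Hrot t0). assert (R1 := Hrot 1).
  set (A0 := (p1 t0 * cos (phi gam bet t0) + p2 t0 * sin (phi gam bet t0)) ^ 2 +
      (q1 t0 * cos (phi gam bet t0) + q2 t0 * sin (phi gam bet t0)) ^ 2) in *.
  set (B0 := (p2 t0 * cos (phi gam bet t0) - p1 t0 * sin (phi gam bet t0)) ^ 2 +
      (q2 t0 * cos (phi gam bet t0) - q1 t0 * sin (phi gam bet t0)) ^ 2) in *.
  set (A1 := (p1 1 * cos (phi gam bet 1) + p2 1 * sin (phi gam bet 1)) ^ 2 +
      (q1 1 * cos (phi gam bet 1) + q2 1 * sin (phi gam bet 1)) ^ 2) in *.
  set (B1 := (p2 1 * cos (phi gam bet 1) - p1 1 * sin (phi gam bet 1)) ^ 2 +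
      (q2 1 * cos (phi gam bet 1) - q1 1 * sin (phi gam bet 1)) ^ 2) in *.
  assert (HA0 : 0 <= A0) by (apply Rplus_le_le_0_compat; apply pow2_ge_0).
  assert (HB0 : 0 <= B0) by (apply Rplus_le_le_0_compat; apply pow2_ge_0).
  assert (HA1 : 0 <= A1) by (apply Rplus_le_le_0_compat; apply pow2_ge_0).
  assert (HB1 : 0 <= B1) by (apply Rplus_le_le_0_compat; apply pow2_ge_0).
  assert (Hs1 : 1 <= sqrt r) by (rewrite <- sqrt_1; apply sqrt_le_1_alt; lra).
  assert (L1 : rownorm2 p1 q1 p2 q2 1 <= sqrt r * (b 1 * A1 + B1 / b 1)).
  { unfold b. rewrite Rpower_one, Rmult_1_r, <- R1.
    replace (sqrt r * (sqrt r * A1 + B1 / sqrt r)) with ((sqrt r * sqrt r) * A1 + B1)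
      by (field; lra).
    rewrite sqrt_sqrt by lra. nra. }
  set (e := 1 / 2 + Rabs p / (2 * q)).
  assert (L0 : b t0 * A0 + B0 / b t0 <= 2 * Rpower r e * rownorm2 p1 q1 p2 q2 t0).
  { assert (Hbt : b t0 = Rpower r (1 / 2 - p / (2 * q))).
    { unfold b, t0. rewrite Rpower_inv_exp by lra.
      rewrite <- Rpower_sqrt by lra. rewrite <- Rpower_plus. f_equal. field. lra. }
    assert (Hpa := Rle_abs p). assert (Hpb := Rle_abs (- p)). rewrite Rabs_Ropp in Hpb.
    assert (I2q : 0 < / (2 * q)) by (apply Rinv_0_lt_compat; lra).
    assert (Hb1 : b t0 <= Rpower r e).
    { rewrite Hbt. apply Rle_Rpower; [lra|]. unfold e, Rdiv. nra. }
    assert (Hb2 : / b t0 <= Rpower r e).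
    { rewrite Hbt, <- Rpower_Ropp. apply Rle_Rpower; [lra|]. unfold e, Rdiv. nra. }
    rewrite <- R0. unfold Rdiv.
    assert (b t0 * A0 <= Rpower r e * A0) by (apply Rmult_le_compat_r; lra).
    assert (B0 * / b t0 <= B0 * Rpower r e) by (apply Rmult_le_compat_l; lra).
    assert (0 <= Rpower r e * (A0 + B0)) by (apply Rmult_le_pos; [left; apply Rpower_pos|lra]).
    lra. }
  apply Rle_trans with (1 := L1).
  set (X := (2 * K + 1) * sqrt r * F 1 -
       (Rabs p / 2 * ln t0 + (2 * K + 1) * sqrt r * F t0)) in U3.
  apply Rle_trans with (sqrt r * (exp X * (2 * Rpower r e *
    (exp (4 * Rpower r (1 - (1 + g) / q)) * Rpower r (2 * g / q))))).
  { apply Rmult_le_compat_l; [lra|]. apply Rle_trans with (1 := U3).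
    apply Rmult_le_compat_l; [left; apply exp_pos|].
    apply Rle_trans with (1 := L0). apply Rmult_le_compat_l; [|exact Hn1].
    assert (H := Rpower_pos r e). lra. }
  right. rewrite <- Rpower_sqrt by lra. unfold Rpower at 1 2 4.
  replace (exp (/ 2 * ln r) * (exp X * (2 * exp (e * ln r) *
    (exp (4 * Rpower r (1 - (1 + g) / q)) * exp (2 * g / q * ln r)))))
  with (2 * (exp (/ 2 * ln r) * (exp X * (exp (e * ln r) *
    (exp (4 * Rpower r (1 - (1 + g) / q)) * exp (2 * g / q * ln r)))))) by ring.
  rewrite <- !exp_plus. f_equal. f_equal. unfold X.
  assert (Hlt0 : ln t0 = - / q * ln r) by (unfold t0, Rpower; apply ln_exp).
  rewrite Hlt0. unfold e. rewrite <- (Rpower_sqrt r) by lra. field. lra.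
Qed.

(** * Packing near a single point *)

Lemma phi_bilipschitz (gam bet A B sg mu M : R) :
  0 <= A -> sg ^ 2 = 1 -> 0 <= mu ->
  (forall s, A < s < B -> mu <= sg * dphi gam bet s <= M) ->
  forall u v, A < u <= v -> v < B ->
    mu * (v - u) <= Rabs (phi gam bet v - phi gam bet u) <= M * (v - u).
Proof.
  intros HA Hsg Hmu Hd u v Hu Hv.
  assert (Hc : forall k w, u <= w <= v ->
    continuous (fun w => sg * phi gam bet w - k * w) w).
  { intros k w Hw. assert (C := continuous_phi gam bet w ltac:(lra)). cont. exact C. }
  assert (Hdd : forall k w, u < w < v ->
    is_derive (fun w => sg * phi gam bet w - k * w) w (sg * dphi gam bet w - k)).
  { intros k w Hw. assert (C := is_derive_phi gam bet w ltac:(lra)). derive_tac. }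
  assert (L : mu * (v - u) <= sg * (phi gam bet v - phi gam bet u)).
  { assert (H := nondecreasing_of_derive _ _ u v ltac:(lra) (Hc mu) (Hdd mu)).
    cbv beta in H. enough (sg * phi gam bet u - mu * u <= sg * phi gam bet v - mu * v) by lra.
    apply H. intros w Hw. specialize (Hd w ltac:(lra)). lra. }
  assert (U : sg * (phi gam bet v - phi gam bet u) <= M * (v - u)).
  { enough (- (sg * phi gam bet u - M * u) <= - (sg * phi gam bet v - M * v)) by lra.
    apply (nondecreasing_of_derive (fun w => - (sg * phi gam bet w - M * w))
      (fun w => - (sg * dphi gam bet w - M))).
    - lra.
    - intros w Hw. apply continuous_Ropp, Hc, Hw.
    - intros w Hw. apply (is_derive_opp (fun w => sg * phi gam bet w - M * w)).
      now apply Hdd.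
    - intros w Hw. specialize (Hd w ltac:(lra)). lra. }
  assert (Hpos : 0 <= mu * (v - u)) by (apply Rmult_le_pos; lra).
  replace (Rabs (phi gam bet v - phi gam bet u)) with (sg * (phi gam bet v - phi gam bet u)).
  { split; assumption. }
  rewrite <- (Rabs_right (sg * (phi gam bet v - phi gam bet u))) by lra.
  rewrite Rabs_mult.
  replace (Rabs sg) with 1; [ring|].
  assert (Hs : (sg - 1) * (sg + 1) = 0) by lra.
  destruct (Rmult_integral _ _ Hs).
  - replace sg with 1 by lra. now rewrite Rabs_R1.
  - replace sg with (-1) by lra. rewrite Rabs_left by lra. ring.
Qed.

(** With x = t^(-bet), phi' vanishes exactly when gam sin x = bet x cos x. For bet > 0 this fails at
    x = 2 pi, for bet = 0 it reads gam sin 1 = 0, and for bet < 0 it cannot hold at both x = 1/4 and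
    x = 1/2. *)
Lemma dphi_nonzero (gam bet : R) : (gam, bet) <> (0, 0) ->
  exists t, 0 < t < 1 /\ dphi gam bet t <> 0.
Proof.
  intros Hne.
  assert (Hred : forall t, 0 < t ->
     gam * sin (Rpower t (- bet)) - bet * Rpower t (- bet) * cos (Rpower t (- bet)) <> 0 ->
     dphi gam bet t <> 0).
  { intros t Ht H. unfold dphi. apply Rmult_integral_contrapositive_currified; [|exact H].
    apply Rgt_not_eq, Rdiv_lt_0_compat; [apply Rpower_pos|exact Ht]. }
  assert (Hinv : forall x, 0 < x -> bet <> 0 -> Rpower (Rpower x (- / bet)) (- bet) = x).
  { intros x Hx Hb. rewrite Rpower_mult.
    replace (- / bet * - bet) with 1 by (field; exact Hb). now apply Rpower_1. }
  destruct (Rtotal_order bet 0) as [Hb|[Hb|Hb]].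
  - assert (Hsmall : forall x, 0 < x < 1 -> 0 < Rpower x (- / bet) < 1).
    { intros x Hx. split; [apply Rpower_pos|].
      unfold Rpower. rewrite <- exp_0. apply exp_increasing.
      assert (ln x < 0) by (rewrite <- ln_1; apply ln_increasing; lra).
      assert (/ bet < 0) by (now apply Rinv_lt_0_compat). nra. }
    destruct (Req_dec (dphi gam bet (Rpower (1 / 4) (- / bet))) 0) as [E1|E1].
    2:{ exists (Rpower (1 / 4) (- / bet)). split; [apply Hsmall; lra|exact E1]. }
    destruct (Req_dec (dphi gam bet (Rpower (1 / 2) (- / bet))) 0) as [E2|E2].
    2:{ exists (Rpower (1 / 2) (- / bet)). split; [apply Hsmall; lra|exact E2]. }
    exfalso.
    assert (Hz : forall x, 0 < x < 1 -> dphi gam bet (Rpower x (- / bet)) = 0 ->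
       gam * sin x = bet * x * cos x).
    { intros x Hx E. destruct (Req_dec (gam * sin x - bet * x * cos x) 0); [lra|].
      exfalso. apply (Hred (Rpower x (- / bet))); [apply Rpower_pos| |exact E].
      rewrite Hinv by lra. assumption. }
    apply Hz in E1; [|lra]. apply Hz in E2; [|lra].
    replace (1 / 2) with (2 * (1 / 4)) in E2 by field.
    rewrite sin_2a, cos_2a in E2.
    assert (Hs : 0 < sin (1 / 4)) by (apply sin_gt_0; [lra|assert (HP := PI2_1); lra]).
    set (s := sin (1 / 4)) in *. set (k := cos (1 / 4)) in *.
    (* doubling the angle would make tan x / x take the same value at 1/4 and 1/2 *)
    assert (E3 : gam * (2 * s * k) = bet * (1 / 4) * k * (2 * k)).
    { replace (gam * (2 * s * k)) with (gam * s * (2 * k)) by ring. rewrite E1. ring. }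
    assert (Hf : bet * (s * s) = 0) by lra.
    assert (0 < s * s) by (now apply Rmult_lt_0_compat). nra.
  - exists (1 / 2). split; [lra|]. apply Hred; [lra|].
    subst bet. rewrite Ropp_0, Rpower_O by lra.
    assert (0 < sin 1) by (apply sin_gt_0; [lra|assert (HP := PI2_1); lra]).
    assert (gam <> 0) by (intros ->; now apply Hne).
    replace (gam * sin 1 - 0 * 1 * cos 1) with (gam * sin 1) by ring.
    apply Rmult_integral_contrapositive_currified; lra.
  - assert (HP := PI2_1). exists (Rpower (2 * PI) (- / bet)). split.
    + split; [apply Rpower_pos|]. unfold Rpower. rewrite <- exp_0. apply exp_increasing.
      assert (0 < ln (2 * PI)) by (rewrite <- ln_1; apply ln_increasing; lra).
      assert (0 < / bet) by (now apply Rinv_0_lt_compat). nra.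
    + apply Hred; [apply Rpower_pos|]. rewrite Hinv by lra.
      rewrite sin_2PI, cos_2PI. nra.
Qed.

Lemma continuous_dphi (gam bet t : R) : 0 < t -> continuous (dphi gam bet) t.
Proof.
  intros Ht. apply (ex_derive_continuous (dphi gam bet)). unfold dphi, Rpower.
  auto_derive. repeat split; lra.
Qed.

Section LowerPacking.
Context {gam bet : R} {P11 P12 P22 : R -> R} (G : gram (phi gam bet) P11 P12 P22).
Let D := gdet P11 P12 P22.

(** A fixed interval around one point with phi' <> 0, where |phi'| lies between m and 3 m, already
    holds of order sqrt r intervals. *)
Lemma pack_sqrt (c : R) : (gam, bet) <> (0, 0) -> 0 < c ->
  exists d R0, 0 < d /\ forall r, R0 <= r ->
    exists a b n, 0 <= a /\ b <= 1 /\ pack D (c / r ^ 2) a b n /\ d * sqrt r <= INR n.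
Proof.
  intros Hne Hc. destruct (dphi_nonzero gam bet Hne) as (t & Ht & Hd).
  set (m := Rabs (dphi gam bet t) / 2).
  assert (Hm : 0 < m) by (unfold m; assert (H := Rabs_pos_lt _ Hd); lra).
  assert (Hcont := continuous_dphi gam bet t ltac:(lra)).
  destruct (proj1 (filterlim_locally (dphi gam bet) (dphi gam bet t)) Hcont (mkposreal m Hm))
    as [[e He] Hloc]. simpl in Hloc.
  set (h := Rmin (e / 2) (Rmin (t / 2) ((1 - t) / 2))).
  assert (Hh : 0 < h /\ h < e /\ h < t /\ h < 1 - t).
  { unfold h. repeat split.
    - repeat apply Rmin_glb_lt; lra.
    - apply Rle_lt_trans with (e / 2); [apply Rmin_l|lra].
    - apply Rle_lt_trans with (t / 2); [|lra].
      eapply Rle_trans; [apply Rmin_r|apply Rmin_l].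
    - apply Rle_lt_trans with ((1 - t) / 2); [|lra].
      eapply Rle_trans; [apply Rmin_r|apply Rmin_r]. }
  set (sg := sign (dphi gam bet t)).
  assert (Hsg : sg ^ 2 = 1 /\ sg * dphi gam bet t = 2 * m).
  { unfold sg, m. destruct (Rdichotomy _ _ Hd) as [Hn|Hp].
    - rewrite sign_eq_m1, Rabs_left by lra. split; field.
    - rewrite sign_eq_1, Rabs_right by lra. split; field. }
  destruct Hsg as [Hsg1 Hsg2].
  assert (Hbl : forall s, t - h < s < t + h -> m <= sg * dphi gam bet s <= 3 * m).
  { intros s Hs. assert (Hb := Hloc s).
    assert (Hbs : Rabs (dphi gam bet s - dphi gam bet t) < m).
    { apply Hb. apply Rabs_def1; unfold minus, plus, opp; simpl; lra. }
    assert (Hx : Rabs (sg * (dphi gam bet s - dphi gam bet t)) < m).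
    { rewrite Rabs_mult. replace (Rabs sg) with 1; [lra|].
      unfold sg. destruct (Rdichotomy _ _ Hd) as [Hn|Hp].
      - rewrite sign_eq_m1, Rabs_left by lra. ring.
      - rewrite sign_eq_1, Rabs_R1 by lra. ring. }
    apply Rabs_def2 in Hx. lra. }
  assert (Hlip := phi_bilipschitz gam bet (t - h) (t + h) sg m (3 * m)
    ltac:(lra) Hsg1 ltac:(lra) Hbl).
  set (q := 1 + 96 * c).
  (* The thresholds in r for the two size conditions of [pack_interval]. *)
  set (R1 := (q / (2 * h)) ^ 2 / m). set (R2 := (2 * q * (3 * m)) ^ 2 / m).
  assert (HR1 : 0 <= R1) by (apply Rdiv_le_0_compat; [apply pow2_ge_0|lra]).
  assert (HR2 : 0 <= R2) by (apply Rdiv_le_0_compat; [apply pow2_ge_0|lra]).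
  exists (2 * h * sqrt m / (2 * q)), (1 + R1 + R2). split.
  { apply Rdiv_lt_0_compat; [|unfold q; lra]. apply Rmult_lt_0_compat; [lra|].
    now apply sqrt_lt_R0. }
  intros r Hr.
  destruct (pack_interval G m (3 * m) (t - h) (t + h) c r) as [n [Hn1 Hn2]]; try lra; auto.
  - fold q. replace (t + h - (t - h)) with (2 * h) by ring.
    replace q with (2 * h * (q / (2 * h))) by (field; lra).
    apply Rmult_le_compat_l; [lra|].
    assert (Hq : 0 <= q / (2 * h)) by (apply Rdiv_le_0_compat; unfold q; lra).
    rewrite <- (sqrt_pow2 _ Hq). apply sqrt_le_1_alt.
    replace ((q / (2 * h)) ^ 2) with (R1 * m) by (unfold R1; field; lra).
    apply Rmult_le_compat_r; lra.
  - fold q. replace ((2 * q * (3 * m)) ^ 2) with (R2 * m) by (unfold R2; field; lra).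
    apply Rmult_le_compat_r; lra.
  - exists (t - h), (t + h), n. split; [lra|]. split; [lra|]. split; [exact Hn1|].
    apply Rle_trans with (2 := Hn2). right. fold q. rewrite sqrt_mult by lra.
    field. unfold q. lra.
Qed.

End LowerPacking.

(** * Packing along the phases of [phi] *)

Lemma Rpower_neg_diff (tau x y : R) : 0 < tau -> 0 < x <= y ->
  tau * Rpower y (- (tau + 1)) * (y - x) <= Rpower x (- tau) - Rpower y (- tau)
  <= tau * Rpower x (- (tau + 1)) * (y - x).
Proof.
  intros Htau Hx.
  assert (Hd : forall k u, 0 < u -> is_derive (fun u => k * u - Rpower u (- tau)) u
     (k + tau * Rpower u (- (tau + 1)))).
  { intros k u Hu. assert (D1 := is_derive_Rpower (- tau) u Hu).
    auto_derive; [repeat split; eexists; eassumption|]. use_derive.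
    replace (- (tau + 1)) with (- tau + - (1)) by ring.
    rewrite Rpower_plus, (Rpower_Ropp u 1), Rpower_1 by lra. field. lra. }
  split.
  - set (k := - (tau * Rpower y (- (tau + 1)))).
    enough (k * x - Rpower x (- tau) <= k * y - Rpower y (- tau)) by (unfold k in *; lra).
    apply (nondecreasing_of_derive (fun u => k * u - Rpower u (- tau))
      (fun u => k + tau * Rpower u (- (tau + 1)))); [lra| | |].
    + intros u Hu. apply (ex_derive_continuous (fun u => k * u - Rpower u (- tau))).
      eexists. apply Hd. lra.
    + intros u Hu. apply Hd. lra.
    + intros u Hu. unfold k.
      assert (H := Rpower_le_base_neg u y (tau + 1) ltac:(lra) ltac:(lra)).
      apply Rmult_le_compat_l with (r := tau) in H; lra.
  - set (k := - (tau * Rpower x (- (tau + 1)))).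
    enough (- (k * x - Rpower x (- tau)) <= - (k * y - Rpower y (- tau)))
      by (unfold k in *; lra).
    apply (nondecreasing_of_derive (fun u => - (k * u - Rpower u (- tau)))
      (fun u => - (k + tau * Rpower u (- (tau + 1))))); [lra| | |].
    + intros u Hu. apply continuous_Ropp.
      apply (ex_derive_continuous (fun u => k * u - Rpower u (- tau))).
      eexists. apply Hd. lra.
    + intros u Hu. apply (is_derive_opp (fun u => k * u - Rpower u (- tau))), Hd. lra.
    + intros u Hu. unfold k.
      assert (H := Rpower_le_base_neg x u (tau + 1) ltac:(lra) ltac:(lra)).
      apply Rmult_le_compat_l with (r := tau) in H; lra.
Qed.

(* For bt = bet > 0 the angle phi is monotone between node bt (2 pi n + 1) and
   node bt (2 pi n), where t^(-bet) runs from 2 pi n + 1 to 2 pi n.  For bet <= 0 phi is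
   monotone on (0, 1] (when p >= 2), and bt = 1 is used. *)
Definition node (bt x : R) : R := Rpower x (- / bt).

Lemma node_decr (bt x y : R) : 0 < bt -> 0 < x <= y -> node bt y <= node bt x.
Proof.
  intros Hb Hx. apply Rpower_le_base_neg; [exact Hx|]. left. now apply Rinv_0_lt_compat.
Qed.

Lemma sin_ge_x_cos (x : R) : 0 <= x <= 1 -> x * cos x <= sin x.
Proof.
  intros Hx.
  enough (sin 0 - 0 * cos 0 <= sin x - x * cos x) by (rewrite sin_0 in *; lra).
  apply (nondecreasing_of_derive (fun u => sin u - u * cos u) (fun u => u * sin u)); [lra| | |].
  - intros u _. apply (ex_derive_continuous (fun u => sin u - u * cos u)). auto_derive. exact I.
  - intros u _. auto_derive; [exact I|ring].
  - intros u Hu. apply Rmult_le_pos; [lra|]. apply sin_ge_0; [lra|].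
    assert (HP := PI2_1). lra.
Qed.

(** Up to the factor s^gam / s, - phi' is bet x cos x - gam sin x with x = s^(-bet). For bet > 0,
    cos x >= 1/2 on the zone and the first term dominates once bet x >= 4 |gam|. For bet <= 0, x cos
    x <= sin x bounds the expression below by (bet - gam) sin x, and bet - gam = p - 1 >= 1. The
    inequality 2 bt + 2 <= p + q makes zones above the scale r^(-1/q) long enough for
    [pack_block]. *)
Lemma dphi_lower (gam bet p q : R) :
  p = bet + 1 - gam -> 2 <= p -> q = p + 2 * Rmax gam 0 ->
  exists bt k N, 0 < bt /\ 0 < k /\ (1 <= N)%nat /\ 2 * bt + 2 <= p + q /\
    forall n s, (N <= n)%nat ->
      node bt (2 * PI * INR n + 1) < s < node bt (2 * PI * INR n) ->
      k * Rpower s (- p) <= - dphi gam bet s.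
Proof.
  intros Hp Hp2 Hq. assert (HP := PI2_1). assert (Hmax := Rmax_l gam 0).
  assert (Hmax' := Rmax_r gam 0).
  assert (Hsplit : forall s, 0 < s ->
    Rpower s (- p) = Rpower s gam / s * Rpower s (- bet)).
  { intros s Hs. rewrite Hp. unfold Rdiv. rewrite <- (Rpower_1 s) at 3 by lra.
    rewrite <- Rpower_Ropp, <- !Rpower_plus. f_equal. ring. }
  assert (Hc : forall s, 0 < s -> 0 < Rpower s gam / s).
  { intros s Hs. apply Rdiv_lt_0_compat; [apply Rpower_pos|exact Hs]. }
  destruct (Rlt_dec 0 bet) as [Hb|Hb].
  - destruct (nfloor_ex (Rabs gam / bet)) as [N [_ HN]].
    { apply Rdiv_le_0_compat; [apply Rabs_pos|exact Hb]. }
    exists bet, (bet / 4), (S N). repeat split; [lra|lra|lia|lra|].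
    intros n s Hn [Hs1 Hs2].
    assert (Hn1 : INR N + 1 <= INR n) by (rewrite <- S_INR; now apply le_INR).
    assert (HN0 := pos_INR N).
    assert (Hs : 0 < s) by (apply Rlt_trans with (2 := Hs1); apply Rpower_pos).
    set (x := Rpower s (- bet)).
    set (y := 2 * PI * INR n) in *.
    assert (Hy : 4 * INR n <= y) by (unfold y; nra).
    assert (Hinv : forall z, 0 < z -> Rpower (node bet z) (- bet) = z).
    { intros z Hz. unfold node. rewrite Rpower_mult.
      replace (- / bet * - bet) with 1 by (field; lra). now apply Rpower_1. }
    assert (Hx1 : y <= x).
    { rewrite <- (Hinv y) by lra. apply Rpower_le_base_neg; lra. }
    assert (Hx2 : x <= y + 1).
    { rewrite <- (Hinv (y + 1)) by lra. apply Rpower_le_base_neg; [|lra].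
      split; [apply Rpower_pos|lra]. }
    assert (Hcos : 1 / 2 <= cos x).
    { replace x with (x - y + 2 * INR n * PI) by (unfold y; ring).
      rewrite cos_period. apply cos_ge_half. lra. }
    assert (Hgam : Rabs gam <= bet * x / 4).
    { apply Rmult_lt_compat_r with (r := bet) in HN; [|lra].
      replace (Rabs gam / bet * bet) with (Rabs gam) in HN by (field; lra).
      assert ((INR N + 1) * bet <= x / 4 * bet) by (apply Rmult_le_compat_r; lra).
      lra. }
    rewrite Hsplit by lra. unfold dphi. fold x. specialize (Hc s Hs).
    assert (Hgs : gam * sin x <= Rabs gam).
    { apply Rle_trans with (1 := Rle_abs _). rewrite Rabs_mult.
      rewrite <- (Rmult_1_r (Rabs gam)) at 2.
      apply Rmult_le_compat_l; [apply Rabs_pos|apply Rabs_le, SIN_bound]. }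
    assert (Hbx : 0 < bet * x) by (apply Rmult_lt_0_compat; lra).
    replace (bet / 4 * (Rpower s gam / s * x)) with (Rpower s gam / s * (bet * x / 4))
      by (field; lra).
    replace (- (Rpower s gam / s * (gam * sin x - bet * x * cos x)))
      with (Rpower s gam / s * (bet * x * cos x - gam * sin x)) by ring.
    apply Rmult_le_compat_l; [lra|]. nra.
  - exists 1, (1 / 2), 1%nat. repeat split; [lra|lra|lia|lra|].
    intros n s Hn [Hs1 Hs2].
    assert (Hn1 : 1 <= INR n) by (change 1 with (INR 1); now apply le_INR).
    assert (Hs : 0 < s) by (apply Rlt_trans with (2 := Hs1); apply Rpower_pos).
    assert (Hs3 : s <= 1).
    { left. apply Rlt_le_trans with (1 := Hs2). unfold node. rewrite Rinv_1.
      apply Rpower_le_1; nra. }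
    set (x := Rpower s (- bet)).
    assert (Hx : 0 < x <= 1).
    { split; [apply Rpower_pos|]. unfold x. rewrite <- (Rpower_O s) by lra.
      apply Rpower_le_exp_small; lra. }
    assert (Hsin := sin_sqr_lower x ltac:(rewrite Rabs_right; lra)).
    assert (Hsin0 : 0 < sin x) by (apply sin_gt_0; lra).
    assert (Hsin2 : x / 2 <= sin x).
    { apply Rsqr_incr_0_var; [|lra]. rewrite !Rsqr_pow2. lra. }
    assert (Hsc := sin_ge_x_cos x ltac:(lra)).
    rewrite Hsplit by lra. unfold dphi. fold x. specialize (Hc s Hs).
    replace (1 / 2 * (Rpower s gam / s * x)) with (Rpower s gam / s * (x / 2))
      by (field; lra).
    replace (- (Rpower s gam / s * (gam * sin x - bet * x * cos x)))
      with (Rpower s gam / s * (bet * (x * cos x) - gam * sin x)) by ring.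
    apply Rmult_le_compat_l; [lra|].
    assert (bet * sin x <= bet * (x * cos x)) by nra.
    assert (1 * sin x <= (bet - gam) * sin x) by (apply Rmult_le_compat_r; lra).
    lra.
Qed.

Section PhasePacking.
Context {gam bet : R} {P11 P12 P22 : R -> R} (G : gram (phi gam bet) P11 P12 P22).
Let D := gdet P11 P12 P22.
Context {F : R -> R} {p : R}.
Context (HF : forall u, 0 < u -> is_derive F u (Rpower u (- (p / 2)))).

Lemma F_diff_le (u v : R) : 0 <= p -> 0 < u <= v ->
  0 <= F v - F u <= (v - u) * Rpower u (- (p / 2)).
Proof.
  intros Hp Hu.
  assert (Hc : forall w, u <= w <= v -> continuous F w).
  { intros w Hw. apply (ex_derive_continuous F). eexists. apply HF. lra. }
  split.
  - enough (F u <= F v) by lra.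
    apply (nondecreasing_of_derive F (fun w => Rpower w (- (p / 2)))); [lra|exact Hc| |].
    + intros w Hw. apply HF. lra.
    + intros w _. left. apply Rpower_pos.
  - set (k := Rpower u (- (p / 2))).
    enough (k * u - F u <= k * v - F v) by lra.
    apply (nondecreasing_of_derive (fun w => k * w - F w)
      (fun w => k - Rpower w (- (p / 2)))); [lra| | |].
    + intros w Hw. specialize (Hc w Hw). cont. exact Hc.
    + intros w Hw. assert (D1 := HF w ltac:(lra)). derive_tac.
    + intros w Hw. assert (H := Rpower_le_base_neg u w (p / 2) ltac:(lra) ltac:(lra)).
      unfold k. lra.
Qed.

(** With x = 2 pi n, let b, a, b' be the nodes of x, x + 1, x + 2 pi, and w = x^(-1/bt - 1) = b^(1 +
    bt). The zone [a, b] has length at least c1 w and the block [b', b] at most 8 tau w, so the zone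
    fills a fixed proportion. As x + 2 pi <= 2 x, also b' >= e2 b, hence powers of t vary by bounded
    factors over the block, and the count on the zone controls the increment of F over the block. *)
Lemma pack_block (c q bt k : R) (N : nat) :
  p = bet + 1 - gam -> 2 <= p -> p <= q -> 0 < c ->
  0 < bt -> 0 < k -> (1 <= N)%nat -> 2 * bt + 2 <= p + q ->
  (forall n s, (N <= n)%nat ->
      node bt (2 * PI * INR n + 1) < s < node bt (2 * PI * INR n) ->
      k * Rpower s (- p) <= - dphi gam bet s) ->
  exists A d, 1 <= A /\ 0 < d /\ forall r n, 1 <= r -> (N <= n)%nat ->
    A * Rpower r (- / q) <= node bt (2 * PI * INR n) ->
    exists m, pack D (c / r ^ 2) (node bt (2 * PI * INR (S n))) (node bt (2 * PI * INR n)) m /\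
      d * sqrt r * (F (node bt (2 * PI * INR n)) - F (node bt (2 * PI * INR (S n)))) <= INR m.
Proof.
  intros Hp Hp2 Hpq Hc Hbt Hk HN Hbq Hlow.
  assert (HP := PI2_1). assert (HP4 := PI_4).
  set (tau := / bt). assert (Htau : 0 < tau) by now apply Rinv_0_lt_compat.
  set (K := Rabs gam + Rabs bet).
  assert (HK : 0 <= K) by (apply Rplus_le_le_0_compat; apply Rabs_pos).
  set (q0 := 1 + 96 * c). assert (Hq0 : 1 < q0) by (unfold q0; lra).
  set (c1 := tau * Rpower 2 (- (tau + 1))).
  assert (Hc1 : 0 < c1) by (apply Rmult_lt_0_compat; [lra|apply Rpower_pos]).
  set (e2 := Rpower 2 (- tau)). assert (He2 : 0 < e2) by apply Rpower_pos.
  set (E := Rpower e2 (- p)). assert (HE : 0 < E) by apply Rpower_pos.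
  set (E2 := Rpower e2 (- (p / 2))). assert (HE2 : 0 < E2) by apply Rpower_pos.
  assert (Hsk : 0 < sqrt k) by now apply sqrt_lt_R0.
  (* One term for each size condition of [pack_interval]: room for an interval in the zone, and
     angles within 1 on each interval. *)
  set (A := 1 + q0 / (c1 * sqrt k) + (2 * q0 * (K * E)) ^ 2 / k).
  assert (HA1 : 0 <= q0 / (c1 * sqrt k)).
  { apply Rdiv_le_0_compat; [lra|now apply Rmult_lt_0_compat]. }
  assert (HA2 : 0 <= (2 * q0 * (K * E)) ^ 2 / k).
  { apply Rdiv_le_0_compat; [apply pow2_ge_0|lra]. }
  assert (HA : 1 <= A) by (unfold A; lra).
  exists A, (c1 * sqrt k / (2 * q0) / (8 * tau * E2)).
  split; [exact HA|]. split.
  { apply Rdiv_lt_0_compat; [apply Rdiv_lt_0_compat; [now apply Rmult_lt_0_compat|lra]|].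
    apply Rmult_lt_0_compat; lra. }
  intros r n Hr Hn Hcut.
  assert (Hn1 : 1 <= INR n) by (change 1 with (INR 1); apply le_INR; lia).
  rewrite S_INR.
  set (x := 2 * PI * INR n) in *.
  replace (2 * PI * (INR n + 1)) with (x + 2 * PI) by (unfold x; ring).
  assert (Hx : 2 * PI <= x) by (unfold x; nra).
  set (b := node bt x) in *. set (b' := node bt (x + 2 * PI)). set (a := node bt (x + 1)).
  assert (Hb : 0 < b <= 1).
  { split; [apply Rpower_pos|]. apply Rpower_le_1; [lra|]. fold tau. lra. }
  assert (Hb'0 : 0 < b') by apply Rpower_pos.
  assert (Ha0 : 0 < a) by apply Rpower_pos.
  assert (Hdouble : node bt (2 * x) = e2 * b).
  { unfold e2, b, node. fold tau. symmetry. apply Rpower_mult_distr; lra. }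
  assert (Ha : e2 * b <= a) by (rewrite <- Hdouble; apply node_decr; lra).
  assert (Hb' : e2 * b <= b') by (rewrite <- Hdouble; apply node_decr; lra).
  assert (Hb'a : b' <= a) by (apply node_decr; lra).
  assert (Hab : a <= b) by (apply node_decr; lra).
  set (w := Rpower x (- (tau + 1))). assert (Hw : 0 < w) by apply Rpower_pos.
  assert (Hwb : w = Rpower b (1 + bt)).
  { unfold w, b, node. rewrite Rpower_mult. f_equal. unfold tau. field. lra. }
  assert (Hd1 : c1 * w <= b - a).
  { destruct (Rpower_neg_diff tau x (x + 1) Htau ltac:(lra)) as [H1 _].
    replace (x + 1 - x) with 1 in H1 by ring. rewrite Rmult_1_r in H1.
    apply Rle_trans with (2 := H1).
    unfold c1. rewrite Rmult_assoc. apply Rmult_le_compat_l; [lra|].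
    unfold w. rewrite Rpower_mult_distr by lra. apply Rpower_le_base_neg; lra. }
  assert (Hd2 : b - b' <= 8 * tau * w).
  { destruct (Rpower_neg_diff tau x (x + 2 * PI) Htau ltac:(lra)) as [_ H1].
    replace (x + 2 * PI - x) with (2 * PI) in H1 by ring.
    apply Rle_trans with (1 := H1). fold w.
    assert (0 < tau * w) by now apply Rmult_lt_0_compat. nra. }
  set (B2 := Rpower b (- (p / 2))). assert (HB2 : 0 < B2) by apply Rpower_pos.
  set (B := Rpower b (- p)). assert (HB0 : 0 < B) by apply Rpower_pos.
  assert (HB : B = B2 * B2).
  { unfold B, B2. rewrite <- Rpower_plus. f_equal. field. }
  assert (Hsr : 0 < sqrt r) by (apply sqrt_lt_R0; lra).
  assert (Hsqrt : sqrt (r * (k * B)) = sqrt r * sqrt k * B2).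
  { rewrite sqrt_mult, sqrt_mult by (try apply Rmult_le_pos; lra).
    rewrite HB, sqrt_square by lra. ring. }
  set (t0 := Rpower r (- / q)) in *. assert (Ht0 : 0 < t0) by apply Rpower_pos.
  assert (HAt0 : 0 < A * t0) by (apply Rmult_lt_0_compat; lra).
  assert (Hlip := phi_bilipschitz gam bet a b (-1) (k * B) (K * E * B)
    ltac:(lra) ltac:(ring) ltac:(left; now apply Rmult_lt_0_compat)).
  specialize (Hlip ltac:(
    intros s Hs; assert (H1 := Hlow n s Hn Hs);
    assert (H2 := dphi_upper gam bet s ltac:(lra)); rewrite <- Hp in H2; fold K in H2;
    assert (H3 := Rpower_le_base_neg s b p ltac:(lra) ltac:(lra)); fold B in H3;
    assert (H4 := Rpower_le_base_neg (e2 * b) s p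
      ltac:(split; [now apply Rmult_lt_0_compat|lra]) ltac:(lra));
    rewrite <- Rpower_mult_distr in H4 by lra; fold E B in H4;
    apply Rabs_le_between in H2;
    assert (k * B <= k * Rpower s (- p)) by (apply Rmult_le_compat_l; lra);
    assert (K * Rpower s (- p) <= K * (E * B)) by (apply Rmult_le_compat_l; lra);
    lra)).
  assert (Hcond1 : q0 <= (b - a) * sqrt (r * (k * B))).
  { rewrite Hsqrt.
    apply Rle_trans with (c1 * w * (sqrt r * sqrt k * B2)).
    2:{ apply Rmult_le_compat_r; [|exact Hd1]. left. repeat apply Rmult_lt_0_compat; lra. }
    replace (c1 * w * (sqrt r * sqrt k * B2)) with (c1 * sqrt k * (sqrt r * (w * B2))) by ring.
    (* w b^(-p/2) = b^(1 + bt - p/2) >= b^(q/2) by 2 bt + 2 <= p + q and b <= 1; at the cut A t0 the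
       right side becomes sqrt r (A t0)^(q/2) = A^(q/2) >= A. *)
    assert (HAq : A <= sqrt r * (w * B2)).
    { rewrite Hwb. unfold B2. rewrite <- Rpower_plus.
      apply Rle_trans with (sqrt r * Rpower b (q / 2)).
      2:{ apply Rmult_le_compat_l; [lra|]. apply Rpower_le_exp_small; lra. }
      apply Rle_trans with (sqrt r * Rpower (A * t0) (q / 2)).
      2:{ apply Rmult_le_compat_l; [lra|]. apply Rle_Rpower_l; lra. }
      rewrite <- Rpower_mult_distr by lra. unfold t0. rewrite Rpower_inv_exp by lra.
      rewrite <- Rpower_sqrt by lra.
      replace (Rpower r (/ 2) * (Rpower A (q / 2) * Rpower r (- (q / 2) / q)))
        with (Rpower A (q / 2) * (Rpower r (/ 2) * Rpower r (- (q / 2) / q))) by ring.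
      rewrite <- Rpower_plus. replace (/ 2 + - (q / 2) / q) with 0 by (field; lra).
      rewrite Rpower_O, Rmult_1_r by lra.
      rewrite <- (Rpower_1 A) at 1 by lra. apply Rle_Rpower; lra. }
    apply Rle_trans with (c1 * sqrt k * A).
    2:{ apply Rmult_le_compat_l; [|exact HAq]. left. now apply Rmult_lt_0_compat. }
    replace q0 with (c1 * sqrt k * (q0 / (c1 * sqrt k))) at 1 by (field; split; lra).
    apply Rmult_le_compat_l; [left; now apply Rmult_lt_0_compat|]. unfold A. lra. }
  assert (Hcond2 : (2 * q0 * (K * E * B)) ^ 2 <= r * (k * B)).
  { replace ((2 * q0 * (K * E * B)) ^ 2) with ((2 * q0 * (K * E)) ^ 2 * B * B) by ring.
    replace (r * (k * B)) with (r * k * B) by ring.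
    apply Rmult_le_compat_r; [lra|].
    (* At the cut, b^(-p) A is at most A^(1 - p) r^(p/q), and both exponents are favourable: p >= 1
       and p <= q. *)
    assert (HBA : B * A <= r).
    { apply Rle_trans with (Rpower (A * t0) (- p) * A).
      { apply Rmult_le_compat_r; [lra|]. apply Rpower_le_base_neg; lra. }
      rewrite <- Rpower_mult_distr by lra. unfold t0. rewrite Rpower_inv_exp by lra.
      replace (- - p / q) with (p / q) by (field; lra).
      rewrite <- (Rpower_1 A) at 2 by lra.
      replace (Rpower A (- p) * Rpower r (p / q) * Rpower A 1)
        with (Rpower A (- p) * Rpower A 1 * Rpower r (p / q)) by ring.
      rewrite <- Rpower_plus. rewrite <- (Rmult_1_l r) at 2.
      apply Rmult_le_compat; try (left; apply Rpower_pos).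
      - replace (- p + 1) with (- (p - 1)) by ring. apply Rpower_le_1; lra.
      - rewrite <- (Rpower_1 r) at 2 by lra. apply Rle_Rpower; [lra|].
        apply Rmult_le_reg_r with q; [lra|]. replace (p / q * q) with p by (field; lra). lra. }
    apply Rle_trans with (k * A * B).
    - apply Rmult_le_compat_r; [lra|].
      replace ((2 * q0 * (K * E)) ^ 2) with (k * ((2 * q0 * (K * E)) ^ 2 / k)) by (field; lra).
      apply Rmult_le_compat_l; [lra|]. unfold A. lra.
    - replace (k * A * B) with (k * (B * A)) by ring. rewrite (Rmult_comm r k).
      apply Rmult_le_compat_l; lra. }
  destruct (pack_interval G (k * B) (K * E * B) a b c r) as [m [Hm1 Hm2]]; auto; try lra.
  { now apply Rmult_lt_0_compat. }
  { repeat apply Rmult_le_pos; lra. }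
  exists m. split.
  { apply (pack_extend_left G _ a); auto; lra. }
  apply Rle_trans with (2 := Hm2). fold q0. rewrite Hsqrt.
  destruct (F_diff_le b' b ltac:(lra) ltac:(lra)) as [_ HFd].
  assert (HFd2 : F b - F b' <= 8 * tau * w * (E2 * B2)).
  { apply Rle_trans with (1 := HFd). apply Rmult_le_compat; [lra|left; apply Rpower_pos|lra|].
    unfold E2, B2. rewrite Rpower_mult_distr by lra.
    apply Rpower_le_base_neg; [|lra]. split; [now apply Rmult_lt_0_compat|lra]. }
  set (d := c1 * sqrt k / (2 * q0) / (8 * tau * E2)).
  assert (Hd : 0 < d).
  { apply Rdiv_lt_0_compat; [apply Rdiv_lt_0_compat; [now apply Rmult_lt_0_compat|lra]|].
    apply Rmult_lt_0_compat; lra. }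
  apply Rle_trans with (d * sqrt r * (8 * tau * w * (E2 * B2))).
  { apply Rmult_le_compat_l; [|exact HFd2]. left. now apply Rmult_lt_0_compat. }
  replace (d * sqrt r * (8 * tau * w * (E2 * B2)))
    with (c1 * w * (sqrt r * sqrt k * B2) / (2 * q0)) by (unfold d; field; lra).
  unfold Rdiv. apply Rmult_le_compat_r; [left; apply Rinv_0_lt_compat; lra|].
  apply Rmult_le_compat_r; [|exact Hd1]. left. repeat apply Rmult_lt_0_compat; lra.
Qed.

(** The blocks are adjacent, so their packings concatenate and the increments of F telescope. *)
Lemma pack_sum (c q : R) :
  p = bet + 1 - gam -> 2 <= p -> q = p + 2 * Rmax gam 0 -> 0 < c ->
  exists A d b, 1 <= A /\ 0 < d /\ 0 < b <= 1 /\ forall r, 1 <= r ->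
    exists a m, 0 <= a /\ pack D (c / r ^ 2) a b m /\
      d * sqrt r * (F b - F (A * Rpower r (- / q))) <= INR m.
Proof.
  intros Hp Hp2 Hq Hc. assert (HP := PI2_1). assert (Hmax := Rmax_r gam 0).
  destruct (dphi_lower gam bet p q Hp Hp2 Hq) as (bt & k & N & Hbt & Hk & HN & Hbq & Hlow).
  destruct (pack_block c q bt k N Hp Hp2 ltac:(lra) Hc Hbt Hk HN Hbq Hlow)
    as (A & d & HA & Hd & Hblock).
  set (b i := node bt (2 * PI * INR (N + i))).
  assert (HN1 : forall i, 1 <= INR (N + i)).
  { intros i. change 1 with (INR 1). apply le_INR. lia. }
  assert (Hb : forall i, 0 < b i <= 1).
  { intros i. split; [apply Rpower_pos|]. specialize (HN1 i).
    apply Rpower_le_1; [nra|left; now apply Rinv_0_lt_compat]. }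
  exists A, d, (b 0%nat). do 3 (split; [auto|]).
  intros r Hr. set (t1 := A * Rpower r (- / q)).
  assert (Ht1 : 0 < t1) by (apply Rmult_lt_0_compat; [lra|apply Rpower_pos]).
  assert (Hsr : 0 < sqrt r) by (apply sqrt_lt_R0; lra).
  assert (Hdr : 0 < d * sqrt r) by now apply Rmult_lt_0_compat.
  assert (Hdecr : forall i, b (S i) <= b i).
  { intros i. unfold b. rewrite <- plus_n_Sm, S_INR. specialize (HN1 i).
    apply node_decr; [lra|]. nra. }
  (* The maximum stops the count at the cut [t1]: F is nondecreasing, so blocks whose right end lies
     below [t1] add nothing to the claim. *)
  assert (Hind : forall i, exists m, pack D (c / r ^ 2) (b i) (b 0%nat) m /\
    d * sqrt r * (F (b 0%nat) - Rmax (F (b i)) (F t1)) <= INR m).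
  { induction i as [|i (m & IH1 & IH2)].
    - exists 0%nat. split; [apply pack_nil; lra|].
      assert (H := Rmax_l (F (b 0%nat)) (F t1)). simpl. nra.
    - destruct (Rle_dec t1 (b i)) as [Hcut|Hcut].
      + destruct (Hblock r (N + i)%nat Hr ltac:(lia) Hcut) as (m' & Hm1 & Hm2).
        rewrite plus_n_Sm in Hm1, Hm2. fold (b i) (b (S i)) in Hm1, Hm2.
        exists (m' + m)%nat. split.
        * apply (pack_app G) with (b := b i) (b' := b i); auto; try lra.
          -- left. apply Hb.
          -- apply Hb.
        * rewrite plus_INR.
          assert (HFi := F_diff_le t1 (b i) ltac:(lra) ltac:(lra)).
          rewrite Rmax_left in IH2 by lra.
          assert (H := Rmax_l (F (b (S i))) (F t1)).
          assert (d * sqrt r * (F (b 0%nat) - Rmax (F (b (S i))) (F t1))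
            <= d * sqrt r * (F (b 0%nat) - F (b (S i)))) by (apply Rmult_le_compat_l; lra).
          lra.
      + exists m. split.
        * apply (pack_extend_left G _ (b i)); auto; [|apply Hb].
          split; [left; apply Hb|apply Hdecr].
        * assert (H1 := F_diff_le (b i) t1 ltac:(lra) ltac:(split; [apply Hb|lra])).
          assert (H := Rmax_r (F (b (S i))) (F t1)).
          rewrite Rmax_right in IH2 by lra.
          apply Rle_trans with (2 := IH2). apply Rmult_le_compat_l; lra. }
  (* For i + 1 above t1^(-bt) the node [b (S i)] lies below the cut, and the maximum is F t1. *)
  destruct (nfloor_ex (Rpower t1 (- bt))) as [i [_ Hi]].
  { left. apply Rpower_pos. }
  destruct (Hind (S i)) as (m & Hm1 & Hm2).
  exists (b (S i)), m. split; [left; apply Hb|]. split; [exact Hm1|].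
  assert (Hbi : b (S i) <= t1).
  { replace t1 with (node bt (Rpower t1 (- bt))).
    2:{ unfold node. rewrite Rpower_mult. replace (- bt * - / bt) with 1 by (field; lra).
        now apply Rpower_1. }
    apply node_decr; [lra|]. split; [apply Rpower_pos|].
    rewrite plus_INR, S_INR. specialize (HN1 0%nat). rewrite Nat.add_0_r in HN1.
    assert (Hi0 := pos_INR i). nra. }
  assert (H1 := F_diff_le (b (S i)) t1 ltac:(lra) ltac:(split; [apply Hb|lra])).
  rewrite Rmax_right in Hm2 by lra. exact Hm2.
Qed.

End PhasePacking.

(** * Asymptotics *)

(** Absorbs the logarithmic losses. With s = r^(1/4), 1 + ln r = 1 + 4 ln s <= 4 s, and 4 K s <= s^2
    once s >= 4 K. *)
Lemma ln_le_sqrt (K : R) : exists R0, forall r, R0 <= r -> K * (1 + ln r) <= sqrt r.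
Proof.
  set (k := Rmax K 0). assert (Hk : 0 <= k) by apply Rmax_r.
  assert (HKk : K <= k) by apply Rmax_l.
  exists (1 + (4 * k) ^ 4). intros r Hr.
  assert (Hk4 : 0 <= (4 * k) ^ 4) by (apply pow_le; lra).
  set (s := sqrt (sqrt r)).
  assert (Hsr : 1 <= sqrt r) by (rewrite <- sqrt_1; apply sqrt_le_1_alt; lra).
  assert (Hs : 1 <= s) by (unfold s; rewrite <- sqrt_1; apply sqrt_le_1_alt; lra).
  assert (Hs2 : s * s = sqrt r) by (apply sqrt_sqrt; lra).
  assert (Hs4 : (s * s) * (s * s) = r) by (rewrite Hs2; apply sqrt_sqrt; lra).
  assert (Hln : ln r = 4 * ln s).
  { rewrite <- Hs4. rewrite !ln_mult by nra. ring. }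
  assert (Hlns : 1 + ln s <= s).
  { rewrite <- (exp_ln s) at 2 by lra. apply exp_ineq1_le. }
  assert (Hlnr : 0 <= ln r) by (rewrite <- ln_1; apply ln_le; lra).
  assert (Hks : 4 * k <= s).
  { apply Rnot_lt_le. intros Hlt.
    assert (s ^ 4 <= (4 * k) ^ 4) by (apply pow_incr; lra).
    replace (s ^ 4) with r in H by (rewrite <- Hs4; ring). lra. }
  apply Rle_trans with (k * (4 * s)).
  - apply Rle_trans with (k * (1 + ln r)).
    + apply Rmult_le_compat_r; lra.
    + apply Rmult_le_compat_l; lra.
  - rewrite <- Hs2. replace (k * (4 * s)) with (4 * k * s) by ring.
    apply Rmult_le_compat_r; lra.
Qed.

Lemma is_derive_Rpower_primitive (s u : R) : s <> 0 -> 0 < u ->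
  is_derive (fun u => Rpower u s / s) u (Rpower u (s - 1)).
Proof.
  intros Hs Hu. assert (D1 := is_derive_Rpower s u Hu).
  auto_derive; [repeat split; eexists; eassumption|]. use_derive.
  unfold Rminus. rewrite Rpower_plus, (Rpower_Ropp u 1), Rpower_1 by lra.
  field. split; lra.
Qed.

(** The first form is the exponent of the cost of the constant frame on [0, t0], the second that of
    sqrt r t0^(1 - p/2); q is the value for which they coincide. *)
Lemma rho_hat_eq (gam bet p q : R) :
  p = bet + 1 - gam -> 2 < p -> q = p + 2 * Rmax gam 0 ->
  rho_hat gam bet = 1 - (1 + Rmax gam 0) / q /\
  rho_hat gam bet = 1 / 2 + (p / 2 - 1) / q.
Proof.
  intros Hp Hp2 Hq. unfold rho_hat. destruct (Rle_dec 0 gam) as [H|H].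
  - rewrite Rmax_left in * by lra. subst. split; field; lra.
  - rewrite Rmax_right in * by lra. subst. split; field; lra.
Qed.

Lemma growth_ge_sqrt (gam bet r : R) : exp 1 <= r -> sqrt r <= growth gam bet r.
Proof.
  intros Hr. assert (He := exp_pos 1).
  assert (Hln : 1 <= ln r) by (rewrite <- (ln_exp 1); apply ln_le; lra).
  assert (He1 := exp_ineq1_le 1).
  assert (Hs := sqrt_pos r).
  unfold growth. destruct (Rlt_dec bet (gam + 1)) as [H1|H1]; [lra|].
  destruct (Req_EM_T bet (gam + 1)) as [H2|H2]; [nra|].
  set (p := bet + 1 - gam). set (q := p + 2 * Rmax gam 0).
  assert (Hp : 2 < p) by (unfold p; lra).
  assert (Hm := Rmax_r gam 0).
  destruct (rho_hat_eq gam bet p q eq_refl Hp eq_refl) as [_ ->].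
  rewrite <- Rpower_sqrt by lra. apply Rle_Rpower; [lra|].
  assert (0 <= (p / 2 - 1) / q) by (apply Rdiv_le_0_compat; unfold q; lra). lra.
Qed.

(** The regimes are p < 2, p = 2 and p > 2. For p <= 2 the choice q = 2, g = 0 suffices: on
    [0, r^(-1/2)] the constant frame costs sqrt r, and on the rest F increases by a bounded amount
    or, for p = 2, by (ln r) / 2. For p > 2 the value of F at the cut dominates. *)
Lemma growth_upper_data (gam bet p : R) : p = bet + 1 - gam ->
  exists q g F C, 0 < q /\ p <= q /\ 0 <= g /\ (g = 0 \/ g = gam) /\ 0 <= C /\
    (forall u, 0 < u -> is_derive F u (Rpower u (- (p / 2)))) /\
    forall r, exp 1 <= r -> Rpower r (1 - (1 + g) / q) <= C * growth gam bet r /\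
      sqrt r * (F 1 - F (Rpower r (- / q))) <= C * growth gam bet r.
Proof.
  intros Hp. assert (He := exp_pos 1). assert (He1 := exp_ineq1_le 1).
  assert (Hlnr : forall r, exp 1 <= r -> 1 <= ln r).
  { intros r Hr. rewrite <- (ln_exp 1). apply ln_le; lra. }
  assert (Hhalf : forall r, exp 1 <= r -> Rpower r (1 - (1 + 0) / 2) = sqrt r).
  { intros r Hr. rewrite <- Rpower_sqrt by lra. f_equal. field. }
  destruct (Req_dec p 2) as [Hp2|Hp2].
  - exists 2, 0, ln, 1. do 5 (split; [lra|]). split.
    + intros u Hu. replace (- (p / 2)) with (- (1)) by (rewrite Hp2; field).
      rewrite Rpower_Ropp, Rpower_1 by lra. auto_derive; [exact Hu|field; lra].
    + intros r Hr. rewrite Hhalf by lra. specialize (Hlnr r Hr).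
      unfold growth. destruct (Rlt_dec bet (gam + 1)); [lra|].
      destruct (Req_EM_T bet (gam + 1)); [|lra].
      assert (Hs := sqrt_pos r).
      rewrite ln_1. unfold Rpower. rewrite ln_exp. split; nra.
  - assert (HF : forall u, 0 < u -> is_derive (fun u => Rpower u (1 - p / 2) / (1 - p / 2)) u
      (Rpower u (- (p / 2)))).
    { intros u Hu. replace (- (p / 2)) with (1 - p / 2 - 1) by ring.
      apply is_derive_Rpower_primitive; lra. }
    destruct (Rlt_dec p 2) as [Hlt|Hge].
    + assert (Hi : 0 < / (1 - p / 2)) by (apply Rinv_0_lt_compat; lra).
      exists 2, 0, (fun u => Rpower u (1 - p / 2) / (1 - p / 2)), (1 + / (1 - p / 2)).
      do 5 (split; [lra|]). split; [exact HF|].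
      intros r Hr. rewrite Hhalf by lra.
      unfold growth. destruct (Rlt_dec bet (gam + 1)); [|lra].
      assert (Hs := sqrt_pos r). rewrite Rpower_one.
      assert (H := Rpower_pos (Rpower r (- / 2)) (1 - p / 2)).
      set (X := Rpower (Rpower r (- / 2)) (1 - p / 2)) in *. split; [nra|].
      unfold Rdiv. rewrite (Rmult_comm (1 + _)). apply Rmult_le_compat_l; [lra|]. nra.
    + set (g := Rmax gam 0). set (q := p + 2 * g).
      assert (Hg : 0 <= g) by apply Rmax_r.
      assert (Hq : 0 < q) by (unfold q; lra).
      destruct (rho_hat_eq gam bet p q Hp ltac:(lra) eq_refl) as [E1 E2]. fold g in E1.
      assert (Hi : 0 < / (p / 2 - 1)) by (apply Rinv_0_lt_compat; lra).
      exists q, g, (fun u => Rpower u (1 - p / 2) / (1 - p / 2)), (1 + / (p / 2 - 1)).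
      split; [exact Hq|]. split; [unfold q; lra|]. split; [exact Hg|].
      split; [unfold g, Rmax; destruct (Rle_dec gam 0); auto|].
      split; [lra|]. split; [exact HF|].
      intros r Hr. unfold growth. destruct (Rlt_dec bet (gam + 1)); [lra|].
      destruct (Req_EM_T bet (gam + 1)); [lra|].
      rewrite <- E1. assert (HX := Rpower_pos r (rho_hat gam bet)).
      split; [nra|].
      rewrite Rpower_one, Rpower_inv_exp by lra.
      replace (sqrt r * (1 / (1 - p / 2) - Rpower r (- (1 - p / 2) / q) / (1 - p / 2)))
        with (sqrt r * Rpower r (- (1 - p / 2) / q) * / (p / 2 - 1) - sqrt r * / (p / 2 - 1))
        by (field; lra).
      rewrite <- Rpower_sqrt at 1 by lra. rewrite <- Rpower_plus.
      replace (/ 2 + - (1 - p / 2) / q) with (rho_hat gam bet) by (rewrite E2; field; lra).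
      assert (Hs := sqrt_pos r).
      assert (0 <= sqrt r * / (p / 2 - 1)) by (apply Rmult_le_pos; lra).
      lra.
Qed.

(** * Comparison of [kappa], w_22 and the maximum on circles with the growth function *)

Section Assembly.
Context {gam bet : R} {P11 P12 P22 : R -> R} (G : gram (phi gam bet) P11 P12 P22).
Let D := gdet P11 P12 P22.

Lemma pack_growth (c : R) : (gam, bet) <> (0, 0) -> 0 < c ->
  exists d R0, 0 < d /\ forall r, R0 <= r ->
    exists a b n, 0 <= a /\ b <= 1 /\ pack D (c / r ^ 2) a b n /\ d * growth gam bet r <= INR n.
Proof.
  intros Hne Hc. set (p := bet + 1 - gam).
  destruct (Rlt_dec bet (gam + 1)) as [H1|H1].
  { destruct (pack_sqrt G c Hne Hc) as (d & R0 & Hd & H). exists d, R0.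
    split; [exact Hd|]. intros r Hr. unfold growth.
    destruct (Rlt_dec bet (gam + 1)); [now apply H|lra]. }
  set (q := p + 2 * Rmax gam 0). assert (Hm := Rmax_r gam 0).
  assert (Hp2 : 2 <= p) by (unfold p; lra).
  assert (Hq : 0 < q) by (unfold q; lra).
  assert (Hiq : 0 < / q) by now apply Rinv_0_lt_compat.
  destruct (Req_EM_T bet (gam + 1)) as [H2|H2].
  - assert (HF : forall u, 0 < u -> is_derive ln u (Rpower u (- (p / 2)))).
    { intros u Hu. replace (- (p / 2)) with (- (1)) by (unfold p; rewrite H2; field).
      rewrite Rpower_Ropp, Rpower_1 by lra. auto_derive; [exact Hu|field; lra]. }
    destruct (pack_sum G HF c q eq_refl Hp2 eq_refl Hc) as (A & d & b & HA & Hd & Hb & H).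
    (* Beyond this threshold one half of (ln r) / q absorbs ln A - ln b. *)
    exists (d * / q / 2), (Rmax 1 (exp (2 * q * (ln A - ln b)))).
    split. { apply Rdiv_lt_0_compat; [now apply Rmult_lt_0_compat|lra]. }
    intros r Hr.
    assert (Hr1 : 1 <= r) by (apply Rle_trans with (2 := Hr), Rmax_l).
    assert (Hr2 : 2 * q * (ln A - ln b) <= ln r).
    { rewrite <- (ln_exp (2 * q * (ln A - ln b))). apply ln_le; [apply exp_pos|].
      apply Rle_trans with (2 := Hr), Rmax_r. }
    destruct (H r Hr1) as (a & m & Ha & Hp & Hcount).
    exists a, b, m. do 3 (split; [auto; lra|]).
    apply Rle_trans with (2 := Hcount). unfold growth.
    destruct (Rlt_dec bet (gam + 1)); [lra|]. destruct (Req_EM_T bet (gam + 1)); [|lra].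
    rewrite ln_mult by (try apply Rpower_pos; lra). unfold Rpower. rewrite ln_exp.
    replace (d * / q / 2 * (sqrt r * ln r)) with (d * sqrt r * (/ q / 2 * ln r)) by (field; lra).
    assert (Hs := sqrt_pos r).
    apply Rmult_le_compat_l; [apply Rmult_le_pos; lra|].
    apply Rmult_le_compat_l with (r := / q / 2) in Hr2; [|lra].
    replace (/ q / 2 * (2 * q * (ln A - ln b))) with (ln A - ln b) in Hr2 by (field; lra).
    lra.
  - set (s := p / 2 - 1). assert (Hs : 0 < s) by (unfold s, p; lra).
    assert (HF : forall u, 0 < u -> is_derive (fun u => Rpower u (1 - p / 2) / (1 - p / 2)) u
      (Rpower u (- (p / 2)))).
    { intros u Hu. replace (- (p / 2)) with (1 - p / 2 - 1) by ring.
      apply is_derive_Rpower_primitive; unfold s in Hs; lra. }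
    destruct (pack_sum G HF c q eq_refl Hp2 eq_refl Hc) as (A & d & b & HA & Hd & Hb & H).
    replace (1 - p / 2) with (- s) in H by (unfold s; ring).
    set (As := Rpower A (- s)). assert (HAs : 0 < As) by apply Rpower_pos.
    set (bs := Rpower b (- s)). assert (Hbs : 0 < bs) by apply Rpower_pos.
    (* Beyond this threshold one half of A^(-s) r^(s/q) absorbs b^(-s). *)
    exists (d * (As / (2 * s))), (Rmax 1 (Rpower (2 * bs / As) (q / s))).
    split. { apply Rmult_lt_0_compat; [lra|]. apply Rdiv_lt_0_compat; lra. }
    intros r Hr.
    assert (Hr1 : 1 <= r) by (apply Rle_trans with (2 := Hr), Rmax_l).
    assert (Hr2 : 2 * bs <= As * Rpower r (s / q)).
    { assert (Hba : 0 < 2 * bs / As) by (apply Rdiv_lt_0_compat; lra).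
      replace (2 * bs) with (As * (2 * bs / As)) by (field; lra).
      apply Rmult_le_compat_l; [lra|].
      rewrite <- (Rpower_1 (2 * bs / As)) by exact Hba.
      replace 1 with (q / s * (s / q)) by (field; lra).
      rewrite <- Rpower_mult. apply Rle_Rpower_l.
      - left. now apply Rdiv_lt_0_compat.
      - split; [apply Rpower_pos|]. apply Rle_trans with (2 := Hr), Rmax_r. }
    destruct (H r Hr1) as (a & m & Ha & Hpk & Hcount).
    exists a, b, m. do 3 (split; [auto; lra|]).
    apply Rle_trans with (2 := Hcount). unfold growth.
    destruct (Rlt_dec bet (gam + 1)); [lra|]. destruct (Req_EM_T bet (gam + 1)); [lra|].
    rewrite <- Rpower_mult_distr by (try apply Rpower_pos; lra).
    rewrite Rpower_inv_exp by lra. fold bs As.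
    replace (- - s / q) with (s / q) by (field; lra).
    destruct (rho_hat_eq gam bet p q eq_refl ltac:(unfold s in Hs; lra) eq_refl) as [_ E2].
    fold s in E2. rewrite E2, Rpower_plus.
    replace (1 / 2) with (/ 2) by field. rewrite Rpower_sqrt by lra.
    assert (Hsr := sqrt_pos r).
    set (X := Rpower r (s / q)) in *.
    replace (d * (As / (2 * s)) * (sqrt r * X)) with (d * sqrt r * (As * X / 2 / s))
      by (field; lra).
    apply Rmult_le_compat_l; [apply Rmult_le_pos; lra|].
    replace (bs / - s - As * X / - s) with ((As * X - bs) / s) by (field; lra).
    apply Rmult_le_compat_r; [left; now apply Rinv_0_lt_compat|]. lra.
Qed.

Lemma kappa_run (c r : R) (k : nat) :
  (forall s t, 0 <= s <= t -> t <= 1 -> detOmega (Hmat gam bet) s t = D s t) ->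
  kappa_is (Hmat gam bet) c r k ->
  (1 <= k)%nat /\ exists sigma : nat -> R, sigma 0%nat = 0 /\
    (forall j, (1 <= j < k)%nat -> sigma (j - 1)%nat < sigma j < 1 /\
       D (sigma (j - 1)%nat) (sigma j) = c / r ^ 2) /\
    D (sigma (k - 1)%nat) 1 <= c / r ^ 2.
Proof.
  intros HD (Hk & sigma & H0 & Hj & Hlast). split; [exact Hk|].
  exists sigma. split; [exact H0|].
  assert (Hpos : forall j, (j < k)%nat -> 0 <= sigma j <= 1).
  { induction j as [|j IH]; intros Hjk; [lra|].
    destruct (Hj (S j) ltac:(lia)) as (_ & H1 & _).
    replace (S j - 1)%nat with j in H1 by lia. specialize (IH ltac:(lia)). lra. }
  split.
  - intros j Hjk. destruct (Hj j Hjk) as (_ & H1 & H2 & _). split; [exact H1|].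
    rewrite <- H2. symmetry. assert (Hp := Hpos (j - 1)%nat ltac:(lia)). apply HD; lra.
  - assert (Hp := Hpos (k - 1)%nat ltac:(lia)). rewrite <- HD by lra. exact Hlast.
Qed.

End Assembly.

Lemma fund_sol_upper (gam bet : R) (W : C -> R -> nat -> nat -> C) :
  (forall z : C, is_fund_sol (Hmat gam bet) z (W z)) ->
  exists C0 R0, 0 < C0 /\ forall r z, R0 <= r -> Cmod z = r ->
    mnorm (W z 1) <= exp (C0 * growth gam bet r).
Proof.
  intros HW. set (p := bet + 1 - gam).
  destruct (growth_upper_data gam bet p eq_refl)
    as (q & g & F & C1 & Hq & Hpq & Hg & Hgg & HC1 & HF & Hgr).
  destruct (row_upper gam bet p q g F eq_refl Hq Hpq Hg Hgg HF) as [C2 Hrow].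
  set (K := Rabs gam + Rabs bet) in *.
  assert (HK : 0 <= K) by (apply Rplus_le_le_0_compat; apply Rabs_pos).
  destruct (ln_le_sqrt (Rabs C2)) as [R1 HR1].
  (* In the 2, one unit absorbs C2 ln r and the other the numerical factor 4 from adding two rows,
     since exp (growth) >= 2. *)
  exists (2 + 4 * C1 + (2 * K + 1) * C1), (Rmax (exp 1) R1).
  assert (HKC : 0 <= (2 * K + 1) * C1) by (apply Rmult_le_pos; lra).
  split; [lra|].
  intros r z Hr Hz.
  assert (Hre : exp 1 <= r) by (apply Rle_trans with (2 := Hr), Rmax_l).
  assert (Hr1 : R1 <= r) by (apply Rle_trans with (2 := Hr), Rmax_r).
  assert (He1 := exp_ineq1_le 1).
  assert (Hlnr : 0 <= ln r) by (rewrite <- ln_1; apply ln_le; lra).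
  assert (Hgs := growth_ge_sqrt gam bet r Hre).
  assert (Hs1 : 1 <= sqrt r) by (rewrite <- sqrt_1; apply sqrt_le_1_alt; lra).
  destruct (Hgr r Hre) as [G1 G2]. specialize (HR1 r Hr1).
  set (gr := growth gam bet r) in *.
  assert (HX : C2 * ln r + 4 * Rpower r (1 - (1 + g) / q)
      + (2 * K + 1) * sqrt r * (F 1 - F (Rpower r (- / q)))
      <= (1 + 4 * C1 + (2 * K + 1) * C1) * gr).
  { assert (C2 * ln r <= gr).
    { apply Rle_trans with (2 := Hgs). apply Rle_trans with (2 := HR1).
      apply Rle_trans with (Rabs C2 * ln r).
      - apply Rmult_le_compat_r; [lra|apply Rle_abs].
      - apply Rmult_le_compat_l; [apply Rabs_pos|lra]. }
    assert ((2 * K + 1) * (sqrt r * (F 1 - F (Rpower r (- / q)))) <= (2 * K + 1) * (C1 * gr))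
      by (apply Rmult_le_compat_l; lra).
    lra. }
  assert (Hxy : fst z ^ 2 + snd z ^ 2 = r ^ 2).
  { rewrite <- Hz. unfold Cmod. rewrite pow2_sqrt; [reflexivity|].
    apply Rplus_le_le_0_compat; apply pow2_ge_0. }
  assert (Hrows : forall i, (i < 2)%nat ->
    Cmod (W z 1 i 0%nat) ^ 2 + Cmod (W z 1 i 1%nat) ^ 2
    <= 2 * exp ((1 + 4 * C1 + (2 * K + 1) * C1) * gr)).
  { intros i Hi. destruct (row_exists z (W z) i (HW z) Hi) as (p1 & q1 & p2 & q2 & Y & HY).
    assert (I0 : rownorm2 p1 q1 p2 q2 0 = 1).
    { destruct (HY 0 ltac:(lra)) as [Y0 Y1]. destruct (HW z) as [Hinit _].
      rewrite Hinit in Y0, Y1 by lia. unfold RtoC, Imat in Y0, Y1.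
      injection Y0; injection Y1; intros E1 E2 E3 E4.
      unfold rownorm2. rewrite <- E1, <- E2, <- E3, <- E4.
      destruct i as [|[|i]]; [simpl; ring|simpl; ring|lia]. }
    assert (H := Hrow r _ _ _ _ _ _ ltac:(lra) Hxy Y I0).
    destruct (HY 1 ltac:(lra)) as [-> ->]. unfold Cmod. simpl fst. simpl snd.
    rewrite !pow2_sqrt by (apply Rplus_le_le_0_compat; apply pow2_ge_0).
    unfold rownorm2 in H.
    assert (exp (C2 * ln r + 4 * Rpower r (1 - (1 + g) / q)
      + (2 * K + 1) * sqrt r * (F 1 - F (Rpower r (- / q))))
      <= exp ((1 + 4 * C1 + (2 * K + 1) * C1) * gr)) by now apply exp_le_compat.
    lra. }
  unfold mnorm. assert (A0 := Hrows 0%nat ltac:(lia)). assert (A1 := Hrows 1%nat ltac:(lia)).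
  set (E := (1 + 4 * C1 + (2 * K + 1) * C1) * gr) in *.
  assert (HE : 0 <= E) by (apply Rmult_le_pos; lra).
  rewrite <- (sqrt_square (exp ((2 + 4 * C1 + (2 * K + 1) * C1) * gr))) by (left; apply exp_pos).
  apply sqrt_le_1_alt.
  replace ((2 + 4 * C1 + (2 * K + 1) * C1) * gr) with (E + gr) by (unfold E; ring).
  apply Rle_trans with (4 * exp E); [lra|].
  rewrite exp_plus.
  assert (Hgr2 : 2 <= exp gr) by (assert (H := exp_ineq1_le gr); lra).
  assert (HE1 : 1 <= exp E) by (assert (H := exp_ineq1_le E); lra).
  assert (4 <= exp gr * exp gr) by nra.
  assert (1 * exp E <= exp E * exp E) by (apply Rmult_le_compat_r; lra).
  replace (exp E * exp gr * (exp E * exp gr)) with ((exp gr * exp gr) * (exp E * exp E)) by ring.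
  apply Rmult_le_compat; lra.
Qed.

Lemma w22_lower (gam bet c : R) (W : C -> R -> nat -> nat -> C) (kappa : R -> nat) :
  0 < c ->
  (forall z : C, is_fund_sol (Hmat gam bet) z (W z)) ->
  (forall r, 0 < r -> kappa_is (Hmat gam bet) c r (kappa r)) ->
  exists a C0, 0 < a /\ forall r, 1 <= r ->
    1 <= Cmod (W ((0%R, r) : C) 1 1%nat 1%nat) /\
    a * INR (kappa r) <= 2 * ln (Cmod (W ((0%R, r) : C) 1 1%nat 1%nat)) + C0 * (1 + ln r).
Proof.
  intros Hc HW Hkap.
  destruct (gram_exists _ (HW 0%C)) as (P11 & P12 & P22 & G & HD).
  set (Q := 1 + sqrt c / (1 + c)).
  assert (HQ : 1 < Q).
  { unfold Q. assert (0 < sqrt c / (1 + c)); [|lra].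
    apply Rdiv_lt_0_compat; [now apply sqrt_lt_R0|lra]. }
  assert (HlnQ : 0 < ln Q) by (rewrite <- ln_1; apply ln_increasing; lra).
  set (m := c ^ 2 / (1 + c)).
  assert (Hm : 0 < m) by (apply Rdiv_lt_0_compat; [now apply pow_lt|lra]).
  (* The loss collects r^2 and m from the prefactor in [norm2_lower] and the three steps missing in
     the exponent; for fewer than three steps |w_22| >= 1 is enough. *)
  exists (ln Q), (2 + Rabs (ln m) + 3 * ln Q). split; [exact HlnQ|].
  intros r Hr. set (z := ((0%R, r) : C)).
  assert (Hlnr : 0 <= ln r) by (rewrite <- ln_1; apply ln_le; lra).
  destruct (row_exists z (W z) 1%nat (HW z) ltac:(lia)) as (p1 & q1 & p2 & q2 & Y & HY).
  destruct (HY 0 ltac:(lra)) as [Y0 Y1]. destruct (HW z) as [Hinit _].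
  rewrite Hinit in Y0, Y1 by lia. unfold RtoC, Imat in Y0, Y1. simpl in Y0, Y1.
  injection Y0; injection Y1; intros E1 E2 E3 E4.
  destruct (kappa_run c r (kappa r) HD (Hkap r ltac:(lra))) as (Hk & sigma & H0 & Hj & _).
  assert (Hj' : forall j, (1 <= j < kappa r)%nat -> sigma (j - 1)%nat < sigma j < 1 /\
     r ^ 2 * gdet P11 P12 P22 (sigma (j - 1)%nat) (sigma j) = c).
  { intros j Hjk. destruct (Hj j Hjk) as [H1 ->]. split; [exact H1|]. field. lra. }
  simpl in Y.
  destruct (norm2_lower G Y c (kappa r) sigma ltac:(lra) Hc ltac:(auto) ltac:(auto)
    ltac:(auto) ltac:(auto) H0 Hj') as [N1 N2].
  destruct (HY 1 ltac:(lra)) as [_ ->].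
  set (n2 := p2 1 ^ 2 + q2 1 ^ 2) in *.
  assert (Hmod : Cmod (p2 1, q2 1) = sqrt n2) by reflexivity. rewrite Hmod.
  split. { rewrite <- sqrt_1. now apply sqrt_le_1_alt. }
  assert (Hln : 2 * ln (sqrt n2) = ln n2).
  { rewrite <- (sqrt_sqrt n2) at 2 by lra. rewrite ln_mult by (apply sqrt_lt_R0; lra). ring. }
  rewrite Hln.
  assert (Hlnn : 0 <= ln n2) by (rewrite <- ln_1; apply ln_le; lra).
  assert (Habs := Rabs_pos (ln m)).
  assert (Hrest : 0 <= (Rabs (ln m) + 3 * ln Q) * ln r) by (apply Rmult_le_pos; lra).
  destruct (Nat.le_gt_cases 3 (kappa r)) as [H3|H3].
  - specialize (N2 H3). fold Q in N2.
    assert (Hr2 : 0 < r ^ 2) by (apply pow_lt; lra).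
    replace (c ^ 2 / ((1 + c) * r ^ 2)) with (m / r ^ 2) in N2 by (unfold m; field; lra).
    assert (Hmr : 0 < m / r ^ 2) by now apply Rdiv_lt_0_compat.
    assert (HQk : 0 < Q ^ (kappa r - 3)) by (apply pow_lt; lra).
    apply ln_le in N2; [|now apply Rmult_lt_0_compat].
    rewrite ln_mult, ln_div, !ln_pow in N2 by lra.
    rewrite minus_INR in N2 by lia. change (INR 3) with (2 + 1) in N2. change (INR 2) with 2 in N2.
    assert (H := Rle_abs (- ln m)). rewrite Rabs_Ropp in H. lra.
  - assert (INR (kappa r) <= 3).
    { replace 3 with (INR 3) by (simpl; ring). apply le_INR. lia. }
    assert (ln Q * INR (kappa r) <= ln Q * 3) by (apply Rmult_le_compat_l; lra).
    lra.
Qed.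

Lemma Cmod_le_mnorm (M : nat -> nat -> C) : Cmod (M 1%nat 1%nat) <= mnorm M.
Proof.
  unfold mnorm. rewrite <- (sqrt_pow2 (Cmod (M 1%nat 1%nat))) at 1 by apply Cmod_ge_0.
  apply sqrt_le_1_alt.
  assert (H1 := pow2_ge_0 (Cmod (M 0%nat 0%nat))).
  assert (H2 := pow2_ge_0 (Cmod (M 0%nat 1%nat))).
  assert (H3 := pow2_ge_0 (Cmod (M 1%nat 0%nat))). lra.
Qed.

(** The bound B also serves the lower estimate: it makes the supremum finite, whereas [real] would
    turn an infinite one into 0. *)
Lemma max_circle_bounds (Wz : C -> nat -> nat -> C) (r B : R) (z : C) :
  Cmod z = r -> (forall z, Cmod z = r -> mnorm (Wz z) <= B) ->
  mnorm (Wz z) <= max_circle Wz r <= B.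
Proof.
  intros Hz HB. unfold max_circle.
  set (E := fun x => exists z : C, Cmod z = r /\ x = mnorm (Wz z)).
  destruct (Lub_Rbar_correct E) as [Hub Hlub].
  assert (H1 := Hub (mnorm (Wz z)) (ex_intro _ z (conj Hz eq_refl))).
  assert (H2 : Rbar_le (Lub_Rbar E) B).
  { apply Hlub. intros x (z' & Hz' & ->). simpl. now apply HB. }
  destruct (Lub_Rbar E); simpl in *; [lra|contradiction|contradiction].
Qed.

Theorem theorem6p9 (gam bet c : R) (W : C -> R -> nat -> nat -> C) (kappa : R -> nat) :
  (gam, bet) <> (0, 0) ->
  0 < c ->
  (forall z : C, is_fund_sol (Hmat gam bet) z (W z)) ->
  (forall r, 0 < r -> kappa_is (Hmat gam bet) c r (kappa r)) ->
  asymp (fun r => ln (max_circle (fun z => W z 1) r)) (growth gam bet) /\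
  asymp (fun r => ln (Cmod (W ((0%R, r) : C) 1 1%nat 1%nat))) (growth gam bet) /\
  asymp (fun r => INR (kappa r)) (growth gam bet).
Proof.
  intros Hne Hc HW Hkap.
  destruct (fund_sol_upper gam bet W HW) as (Cu & Ru & HCu & Hup).
  destruct (w22_lower gam bet c W kappa Hc HW Hkap) as (a & C0 & Ha & Hlow).
  destruct (gram_exists _ (HW 0%C)) as (P11 & P12 & P22 & G & HD).
  destruct (pack_growth G c Hne Hc) as (d & Rd & Hd & Hpack).
  destruct (ln_le_sqrt C0) as [R1 HR1].
  destruct (ln_le_sqrt (2 * C0 / (a * d))) as [R2 HR2].
  set (R0 := Rmax (exp 1) (Rmax Ru (Rmax Rd (Rmax R1 R2)))).
  assert (HR0 : forall r, R0 <= r ->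
    exp 1 <= r /\ Ru <= r /\ Rd <= r /\ R1 <= r /\ R2 <= r).
  { intros r Hr.
    assert (M1 := Rmax_l (exp 1) (Rmax Ru (Rmax Rd (Rmax R1 R2)))).
    assert (M2 := Rmax_r (exp 1) (Rmax Ru (Rmax Rd (Rmax R1 R2)))).
    assert (M3 := Rmax_l Ru (Rmax Rd (Rmax R1 R2))).
    assert (M4 := Rmax_r Ru (Rmax Rd (Rmax R1 R2))).
    assert (M5 := Rmax_l Rd (Rmax R1 R2)). assert (M6 := Rmax_r Rd (Rmax R1 R2)).
    assert (M7 := Rmax_l R1 R2). assert (M8 := Rmax_r R1 R2).
    unfold R0 in Hr. lra. }
  assert (Had : 0 < a * d) by now apply Rmult_lt_0_compat.
  (* The estimates close a cycle: growth is bounded by kappa through packings, kappa by log |w_22|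
     up to a logarithm, log |w_22| by the logarithm of the maximum, and this by growth. *)
  assert (Hall : forall r, R0 <= r ->
    d * growth gam bet r <= INR (kappa r) /\
    INR (kappa r) <= (2 * Cu + 1) / a * growth gam bet r /\
    a * d / 4 * growth gam bet r <= ln (Cmod (W ((0%R, r) : C) 1 1%nat 1%nat)) /\
    ln (Cmod (W ((0%R, r) : C) 1 1%nat 1%nat)) <= ln (max_circle (fun z => W z 1) r) /\
    ln (max_circle (fun z => W z 1) r) <= Cu * growth gam bet r).
  { intros r Hr. destruct (HR0 r Hr) as (L1 & L2 & L3 & L4 & L5).
    assert (He1 := exp_ineq1_le 1).
    assert (Hgs := growth_ge_sqrt gam bet r L1).
    set (gr := growth gam bet r) in *.
    destruct (Hlow r ltac:(lra)) as [W1 W2].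
    set (w := Cmod (W ((0%R, r) : C) 1 1%nat 1%nat)) in *.
    specialize (HR1 r L4). specialize (HR2 r L5).
    assert (Hz : Cmod ((0%R, r) : C) = r).
    { unfold Cmod. simpl fst. simpl snd. replace (0 ^ 2 + r ^ 2) with (r ^ 2) by ring.
      apply sqrt_pow2. lra. }
    destruct (max_circle_bounds (fun z => W z 1) r (exp (Cu * gr)) ((0%R, r) : C) Hz) as [X1 X2].
    { intros z Hz'. now apply Hup. }
    assert (X3 := Cmod_le_mnorm (W ((0%R, r) : C) 1)). fold w in X3.
    assert (Y1 : ln w <= ln (max_circle (fun z => W z 1) r)) by (apply ln_le; lra).
    assert (Y2 : ln (max_circle (fun z => W z 1) r) <= Cu * gr).
    { rewrite <- (ln_exp (Cu * gr)). apply ln_le; lra. }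
    destruct (kappa_run c r (kappa r) HD (Hkap r ltac:(lra))) as (Hk & sigma & H0 & Hj & Hlast).
    destruct (Hpack r L3) as (b & b' & n & Hb & Hb' & Hp & Hn).
    assert (Hnk := pack_greedy G _ _ sigma Hk H0 Hj Hlast b b' n Hp Hb' 0%nat
      ltac:(lia) ltac:(rewrite H0; lra)).
    assert (Hnk' : INR n <= INR (kappa r)) by (apply le_INR; lia).
    fold gr in Hn.
    assert (K1 : d * gr <= INR (kappa r)) by lra.
    split; [exact K1|]. split.
    { apply Rmult_le_reg_l with a; [exact Ha|].
      replace (a * ((2 * Cu + 1) / a * gr)) with (2 * (Cu * gr) + gr) by (field; lra). lra. }
    split; [|split; assumption].
    (* The logarithmic loss is at most half of a kappa, which leaves 2 log |w_22| >= (a d / 2)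
       growth. *)
    assert (K2 : 2 * (C0 * (1 + ln r)) <= a * d * gr).
    { apply Rle_trans with (a * d * sqrt r); [|apply Rmult_le_compat_l; lra].
      apply Rmult_le_compat_l with (r := a * d) in HR2; [|lra].
      replace (a * d * (2 * C0 / (a * d) * (1 + ln r))) with (2 * (C0 * (1 + ln r))) in HR2
        by (field; lra).
      exact HR2. }
    assert (K3 : a * (d * gr) <= a * INR (kappa r)) by (apply Rmult_le_compat_l; lra).
    lra. }
  split; [|split].
  - exists (a * d / 4), Cu, R0. split; [lra|]. split; [exact HCu|].
    intros r Hr. destruct (Hall r Hr) as (_ & _ & H3 & H4 & H5). lra.
  - exists (a * d / 4), Cu, R0. split; [lra|]. split; [exact HCu|].
    intros r Hr. destruct (Hall r Hr) as (_ & _ & H3 & H4 & H5). lra.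
  - exists d, ((2 * Cu + 1) / a), R0. split; [exact Hd|].
    split; [apply Rdiv_lt_0_compat; lra|].
    intros r Hr. destruct (Hall r Hr) as (H1 & H2 & _). lra.
Qed.
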